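(* Let $G$ be a torsion-free elementary amenable group with a nested sequence of normal subgroups $G\supset G_1\supset G_2\supset\cdots$ such that $\bigcap_k G_k=\{1\}$. Assume $G/G_i\in\mathcal{G}$ for every $i\in\mathbb{N}$. Let $A\in M(d\times d,\mathbb{C}G)$ and let $A_k\in M(d\times d,\mathbb{C}[G/G_k])$ be its image under the map induced by the epimorphism $G\to G/G_k$. Then $$\dim_G(\ker(A))=\lim_{k\to\infty}\dim_{G/G_k}(\ker(A_k)).$$
   Context: For a discrete group $G$, $l^2(G)=\{f\colon G\to\mathbb{C}\mid \sum_{g\in G}|f(g)|^2<\infty\}$. A matrix $A\in M(d\times d,\mathbb{C}G)$ acts by left convolution as a bounded operator $A\colon l^2(G)^d\to l^2(G)^d$, which commutes with the right $G$-action. For a bounded operator $T$ on $l^2(G)^d$ commuting with the right $G$-action put $\mathrm{tr}_G(T)=\sum_{i=1}^d\langle Te_i,e_i\rangle$, where $e_i\in l^2(G)^d$ has the trivial element $1\in G\subset l^2(G)$ in the $i$-th position and zeros elsewhere. Put $\dim_G(\ker A)=\mathrm{tr}_G(\mathrm{pr}_{\ker A})$, where $\mathrm{pr}_{\ker A}$ is the orthogonal projection onto $\ker A$. The class of elementary amenable groups is the smallest class of groups containing all cyclic and all finite groups and closed under group extensions and directed unions. Directed system: the index set $I$ is partially ordered, any two $i,j\in I$ admit $k\in I$ with $i<k$, $j<k$, and there are compatible homomorphisms $G_i\to G_j$ for $i<j$ (for direct limits) or $G_j\to G_i$ for $i<j$ (for inverse limits). Generalized amenable extension: let $G$ be a finitely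 generated discrete group with a finite symmetric set of generators $S$, and let $H$ be a normal subgroup of $G$. $G$ is a generalized amenable extension of $H$ if there is a set $X$ with a free left $G$-action and a commuting free right $H$-action, and a sequence of $H$-invariant subsets $X_1\subset X_2\subset\cdots\subset X$ with $\bigcup_k X_k=X$, $|X_k/H|<\infty$ for every $k$, and $\frac{|(S\cdot X_k-X_k)/H|}{|X_k/H|}\to 0$ as $k\to\infty$ (here $S\cdot X_k-X_k$ is the set difference). $\mathcal{G}$ is the smallest class of groups which contains the trivial group and is closed under: (i) if $H\in\mathcal{G}$ and $G$ is a generalized amenable extension of $H$, then $G\in\mathcal{G}$; (ii) if $H\in\mathcal{G}$ and $U$ is a subgroup of $H$, then $U\in\mathcal{G}$; (iii) if $G$ is the direct or inverse limit of a directed system of groups $G_i\in\mathcal{G}$, then $G\in\mathcal{G}$. *)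

(* Defs.v *)
From HB Require Import structures.
From mathcomp Require Import all_boot all_order all_algebra.
From mathcomp Require Import generic_quotient finmap.
From mathcomp Require Import all_classical all_reals all_analysis.
From mathcomp Require Import complex.
From mathcomp Require summability.

Set Implicit Arguments.
Unset Strict Implicit.
Unset Printing Implicit Defensive.

Import Order.TTheory GRing.Theory Num.Theory.
Import numFieldNormedType.Exports.

Local Open Scope classical_set_scope.
Local Open Scope quotient_scope.
Local Open Scope ring_scope.

Section Subgroup.
Variables (G : groupType) (H : groupClosed G).

Definition subgroup_type : Type := {x : G | x \in H}.

HB.instance Definition _ := SubChoice.on subgroup_type.

Fact subgroup_closed : group_closed H.
Proof. by split; [exact: gpred1 | move=> x y; exact: gpredF]. Qed.

HB.instance Definition _ :=
  SubChoice_isSubGroup.Build G _ subgroup_type subgroup_closed.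

End Subgroup.

Structure normalSubgroup (G : groupType) := NormalSubgroup {
  normal_val :> groupClosed G;
  normal_conj : forall x g : G, x \in normal_val -> (x ^ g)%g \in normal_val
}.

Section Quotient.
Variables (G : groupType) (N : normalSubgroup G).

Definition coset_rel : rel G := fun x y => (x^-1 * y)%g \in N.

Fact coset_rel_refl : reflexive coset_rel.
Proof. by move=> x; rewrite /coset_rel mulVg gpred1. Qed.

Fact coset_rel_sym : symmetric coset_rel.
Proof. by move=> x y; rewrite /coset_rel -gpredV invgM invgK. Qed.

Fact coset_rel_trans : transitive coset_rel.
Proof.
move=> y x z; rewrite /coset_rel => xy yz.
have -> : (x^-1 * z = (x^-1 * y) * (y^-1 * z))%g.
  by rewrite -mulgA mulVKg.
exact: gpredM.
Qed.

Canonical coset_equiv :=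
  EquivRel coset_rel coset_rel_refl coset_rel_sym coset_rel_trans.

Definition quotient_group : Type := {eq_quot coset_equiv}.

HB.instance Definition _ := Choice.on quotient_group.

Definition quo (x : G) : quotient_group := \pi_({eq_quot coset_equiv}) x.

Definition quo_repr (q : quotient_group) : G :=
  repr (q : {eq_quot coset_equiv}).

Fact quo_reprK : cancel quo_repr quo.
Proof. by move=> q; exact: reprK. Qed.

Fact quo_eqP (x y : G) : reflect (quo x = quo y) ((x^-1 * y)%g \in N).
Proof. apply: (iffP idP) => [xy|/eqmodP//]; exact/eqmodP. Qed.

Definition quo_mul (q r : quotient_group) := quo (quo_repr q * quo_repr r)%g.
Definition quo_inv (q : quotient_group) := quo (quo_repr q)^-1%g.

Fact quo_mulE (x y : G) : quo_mul (quo x) (quo y) = quo (x * y)%g.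
Proof.
have /quo_eqP xN : quo (quo_repr (quo x)) = quo x by rewrite quo_reprK.
have /quo_eqP yN : quo (quo_repr (quo y)) = quo y by rewrite quo_reprK.
set x' := quo_repr _ in xN *; set y' := quo_repr _ in yN *.
apply/quo_eqP.
have -> : ((x' * y')^-1 * (x * y) =
           ((x'^-1 * x) ^ y') * (y'^-1 * y))%g.
  by rewrite /conjg invgM -!mulgA mulVKg.
by rewrite gpredM// normal_conj.
Qed.

Fact quo_invE (x : G) : quo_inv (quo x) = quo x^-1%g.
Proof.
have /quo_eqP xN : quo (quo_repr (quo x)) = quo x by rewrite quo_reprK.
set x' := quo_repr _ in xN *.
apply/quo_eqP; rewrite invgK.
have -> : (x' * x^-1 = ((x'^-1 * x)^-1) ^ x'^-1)%g.
  by rewrite /conjg invgM !invgK -mulgA mulgV mulg1.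
by rewrite normal_conj// gpredV.
Qed.

Fact quo_mulA : associative quo_mul.
Proof.
move=> q r s; rewrite -(quo_reprK q) -(quo_reprK r) -(quo_reprK s).
by rewrite !quo_mulE mulgA.
Qed.

Fact quo_mul1 : left_id (quo 1%g) quo_mul.
Proof. by move=> q; rewrite -(quo_reprK q) quo_mulE mul1g. Qed.

Fact quo_1mul : right_id (quo 1%g) quo_mul.
Proof. by move=> q; rewrite -(quo_reprK q) quo_mulE mulg1. Qed.

Fact quo_mulV : left_inverse (quo 1%g) quo_inv quo_mul.
Proof. by move=> q; rewrite -(quo_reprK q) quo_invE quo_mulE mulVg. Qed.

Fact quo_Vmul : right_inverse (quo 1%g) quo_inv quo_mul.
Proof. by move=> q; rewrite -(quo_reprK q) quo_invE quo_mulE mulgV. Qed.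

HB.instance Definition _ := isGroup.Build quotient_group
  quo_mulA quo_mul1 quo_1mul quo_mulV quo_Vmul.

Fact quo_morph : {morph quo : x y / (x * y)%g >-> (x * y)%g}.
Proof. by move=> x y; rewrite -quo_mulE. Qed.

HB.instance Definition _ := isMultiplicative.Build G quotient_group quo quo_morph.

End Quotient.

Definition torsion_free (G : groupType) : Prop :=
  forall (x : G) (n : nat), (0 < n)%N -> (x ^+ n)%g = 1%g -> x = 1%g.

Definition cyclic_group (G : groupType) : Prop :=
  exists g : G, forall x : G, exists n : nat, x = (g ^+ n)%g \/ x = (g ^- n)%g.

Definition short_exact (N E Q : groupType)
    (i : {multiplicative N -> E}) (p : {multiplicative E -> Q}) : Prop :=
  [/\ injective i, forall q, exists e, p e = q
    & forall e, p e = 1%g <-> exists n, i n = e].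

(* G is the union of the upward directed family H of its subgroups. *)
Definition directed_union (G : groupType) (I : Type) (H : I -> groupClosed G) :
    Prop :=
  (forall i j, exists k, {subset H i <= H k} /\ {subset H j <= H k}) /\
  (forall x : G, exists i, x \in H i).

Inductive elementary_amenable : groupType -> Prop :=
| ea_cyclic (G : groupType) : cyclic_group G -> elementary_amenable G
| ea_finite (G : groupType) : finite_set [set: G] -> elementary_amenable G
| ea_extension (N E Q : groupType)
    (i : {multiplicative N -> E}) (p : {multiplicative E -> Q}) :
    short_exact i p -> elementary_amenable N -> elementary_amenable Q ->
    elementary_amenable E
| ea_directed_union (G : groupType) (I : Type) (H : I -> groupClosed G) :
    directed_union H -> (forall i, elementary_amenable (subgroup_type (H i))) ->
    elementary_amenable G.

Definition symmetric_generating_set (G : groupType) (S : set G) : Prop :=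
  (forall s, S s -> S s^-1%g) /\
  (forall U : groupClosed G, (forall s, S s -> s \in U) -> forall x, x \in U).

Definition free_left_action (G : groupType) (X : Type) (act : G -> X -> X) :
    Prop :=
  [/\ forall x, act 1%g x = x,
      forall g h x, act (g * h)%g x = act g (act h x)
    & forall g x, act g x = x -> g = 1%g].

Definition free_right_action (H : groupType) (X : Type) (act : X -> H -> X) :
    Prop :=
  [/\ forall x, act x 1%g = x,
      forall x g h, act x (g * h)%g = act (act x g) h
    & forall x h, act x h = x -> h = 1%g].

(* Y / H, as a set of subsets of X *)
Definition orbits (H : groupType) (X : Type) (act : X -> H -> X) (Y : set X) :
    set (set X) :=
  [set range (act x) | x in Y].

Section GeneralizedAmenable.
Variable R : realType.

(* The sets X_k are required to be nonempty, so that the Folner quotients are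
   not of the form 0 / 0. *)
Definition generalized_amenable_extension (G : groupType)
    (H : normalSubgroup G) : Prop :=
  exists (S : set G) (X : Type) (lact : G -> X -> X)
         (ract : X -> subgroup_type H -> X) (Xk : nat -> set X),
  [/\ finite_set S, symmetric_generating_set S,
      free_left_action lact, free_right_action ract &
      (forall g x h, ract (lact g x) h = lact g (ract x h))] /\
  [/\ forall k x h, Xk k x -> Xk k (ract x h),
      forall k, Xk k `<=` Xk k.+1,
      \bigcup_k Xk k = [set: X],
      forall k, Xk k !=set0 /\ finite_set (orbits ract (Xk k)) &
      (let boundary k := [set lact s x | s in S & x in Xk k] `\` Xk k in
       (#|` fset_set (orbits ract (boundary k)) |%:R /
        #|` fset_set (orbits ract (Xk k)) |%:R : R) @[k --> \oo] --> (0 : R))].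

End GeneralizedAmenable.

Section Limits.
Variables (disp : Order.disp_t) (I : porderType disp) (Gs : I -> groupType).

Definition directed_index : Prop :=
  forall i j : I, exists k, (i < k)%O /\ (j < k)%O.

Section Direct.
Variable phi : forall i j, (i < j)%O -> {multiplicative Gs i -> Gs j}.

Definition direct_system : Prop :=
  directed_index /\
  forall i j k (ij : (i < j)%O) (jk : (j < k)%O) (ik : (i < k)%O) x,
    phi jk (phi ij x) = phi ik x.

Definition cocone (L : groupType) (f : forall i, {multiplicative Gs i -> L}) :
    Prop :=
  forall i j (ij : (i < j)%O) x, f j (phi ij x) = f i x.

Definition is_direct_limit (G : groupType)
    (psi : forall i, {multiplicative Gs i -> G}) : Prop :=
  cocone psi /\
  forall (L : groupType) (f : forall i, {multiplicative Gs i -> L}), cocone f ->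
    exists h : {multiplicative G -> L},
      (forall i x, h (psi i x) = f i x) /\
      forall h' : {multiplicative G -> L},
        (forall i x, h' (psi i x) = f i x) -> h' =1 h.

End Direct.

Section Inverse.
Variable phi : forall i j, (i < j)%O -> {multiplicative Gs j -> Gs i}.

Definition inverse_system : Prop :=
  directed_index /\
  forall i j k (ij : (i < j)%O) (jk : (j < k)%O) (ik : (i < k)%O) x,
    phi ij (phi jk x) = phi ik x.

Definition cone (L : groupType) (f : forall i, {multiplicative L -> Gs i}) :
    Prop :=
  forall i j (ij : (i < j)%O) x, phi ij (f j x) = f i x.

Definition is_inverse_limit (G : groupType)
    (psi : forall i, {multiplicative G -> Gs i}) : Prop :=
  cone psi /\
  forall (L : groupType) (f : forall i, {multiplicative L -> Gs i}), cone f ->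
    exists h : {multiplicative L -> G},
      (forall i x, psi i (h x) = f i x) /\
      forall h' : {multiplicative L -> G},
        (forall i x, psi i (h' x) = f i x) -> h' =1 h.

End Inverse.
End Limits.

Inductive class_G (R : realType) : groupType -> Prop :=
| class_G_trivial (G : groupType) : (forall x : G, x = 1%g) -> class_G R G
| class_G_amenable (G : groupType) (H : normalSubgroup G) :
    class_G R (subgroup_type H) -> generalized_amenable_extension R H ->
    class_G R G
| class_G_subgroup (H : groupType) (U : groupClosed H) :
    class_G R H -> class_G R (subgroup_type U)
| class_G_direct_limit (disp : Order.disp_t) (I : porderType disp)
    (Gs : I -> groupType)
    (phi : forall i j, (i < j)%O -> {multiplicative Gs i -> Gs j})
    (G : groupType) (psi : forall i, {multiplicative Gs i -> G}) :
    direct_system phi -> is_direct_limit phi psi ->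
    (forall i, class_G R (Gs i)) -> class_G R G
| class_G_inverse_limit (disp : Order.disp_t) (I : porderType disp)
    (Gs : I -> groupType)
    (phi : forall i j, (i < j)%O -> {multiplicative Gs j -> Gs i})
    (G : groupType) (psi : forall i, {multiplicative G -> Gs i}) :
    inverse_system phi -> is_inverse_limit phi psi ->
    (forall i, class_G R (Gs i)) -> class_G R G.

(* R[i], the field of complex numbers, gets its norm topology through ^o. *)
Notation Cplx R := (R[i]^o).

Section L2.
Variables (R : realType) (G : groupType).

Definition l2 : set (G -> Cplx R) :=
  [set f | (\esum_(g in [set: G]) (complex.Re `|f g| ^+ 2)%:E < +oo)%E].

Definition l2_inner (f h : G -> Cplx R) : Cplx R :=
  summability.sum (fun g => f g * (h g)^* : Cplx R).

(* Finitely supported functions; a stands for the sum of the a g * g. *)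
Definition group_algebra : Type := {fsfun G -> Cplx R with 0}.

Definition convolution (a : group_algebra) (f : G -> Cplx R) : G -> Cplx R :=
  fun g => \sum_(h <- finsupp a) a h * f (h^-1 * g)%g.

Variable d : nat.

Definition l2d : set ('I_d -> G -> Cplx R) := [set u | forall i, l2 (u i)].

Definition l2d_inner (u v : 'I_d -> G -> Cplx R) : Cplx R :=
  \sum_(i < d) l2_inner (u i) (v i).

Definition matrix_op (A : 'M[group_algebra]_d) (u : 'I_d -> G -> Cplx R) :
    'I_d -> G -> Cplx R :=
  fun i g => \sum_(j < d) convolution (A i j) (u j) g.

Definition matrix_ker (A : 'M[group_algebra]_d) : set ('I_d -> G -> Cplx R) :=
  [set u | l2d u /\ forall i g, matrix_op A u i g = 0].

Definition is_orthogonal_projection (K : set ('I_d -> G -> Cplx R))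
    (u p : 'I_d -> G -> Cplx R) : Prop :=
  K p /\ forall w, K w -> l2d_inner (fun i g => u i g - p i g) w = 0.

(* For K a closed subspace of l^2(G)^d and u in l^2(G)^d, there is exactly one p
   with is_orthogonal_projection K u p. *)
Definition orthogonal_projection (K : set ('I_d -> G -> Cplx R))
    (u : 'I_d -> G -> Cplx R) : 'I_d -> G -> Cplx R :=
  xget (fun _ _ => 0) (is_orthogonal_projection K u).

Definition l2d_unit (i : 'I_d) : 'I_d -> G -> Cplx R :=
  fun j g => if (j == i) && (g == 1%g) then 1 else 0.

Definition trG (T : ('I_d -> G -> Cplx R) -> ('I_d -> G -> Cplx R)) : Cplx R :=
  \sum_(i < d) l2d_inner (T (l2d_unit i)) (l2d_unit i).

Definition dimG_ker (A : 'M[group_algebra]_d) : Cplx R :=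
  trG (orthogonal_projection (matrix_ker A)).

End L2.

Section GroupAlgebraMap.
Variables (R : realType) (G : groupType) (N : normalSubgroup G).

Local Open Scope fset_scope.

Definition quo_algebra (a : group_algebra R G) :
    group_algebra R (quotient_group N) :=
  [fsfun q in [fset quo N g | g in finsupp a] =>
     \sum_(g <- finsupp a | quo N g == q) a g | 0].

End GroupAlgebraMap.

Arguments quo_algebra {R G} N a.

(* Main.v *)
Require Import Defs.
From mathcomp Require Import all_boot all_order all_algebra.
From mathcomp Require Import finmap.
From mathcomp Require Import all_classical all_reals all_analysis.
From mathcomp Require Import complex.
From mathcomp Require Import zify ring lra.
From mathcomp Require summability.

(** The proof is a comparison of both sides with one and the same finite matrix.

    Let F be a finite subset of G, and let P be the orthogonal projection of
    l^2(G)^d onto ker A. The compression M of P to the vectors supported on F is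
    a matrix with 0 <= M <= 1. Since P commutes with right translations, each
    delta function at (i, x) contributes to the trace what the one at (i, 1)
    contributes, so tr M = |F| dim_G(ker A) ([trace_gram]). Let K_F be the space
    of the vectors supported on F that A kills.
    - M is the identity on K_F, hence dim K_F <= tr M ([mxrank_le_trace]).
    - A row of M is the restriction to F of an element of ker A. At a point g
      such that h^-1 g is in F for all h in the supports of the entries of A,
      the equation (A u)(g) = 0 only involves values of u on F; so the rows of M
      satisfy all the equations defining K_F except those at boundary points of
      F, and tr M <= dim K_F + d |boundary| ([trace_le_mxrank]).
    Together, dim K_F <= |F| dim_G(ker A) <= dim K_F + d |boundary|
    ([dimG_ker_window]). The space K_F is the kernel of a finite matrix whose
    entries are the coefficients of A at the elements g x^-1 with x in F and g
    in supp(A) F.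

    For k large, the projection of G onto G / G_k is injective on the finitely
    many elements of G involved, because the G_k decrease to 1. Then A_k and the
    image of F produce the same finite matrix and the same boundary, and
    |dim_G(ker A) - dim_(G/G_k)(ker A_k)| <= d |boundary| / |F|
    ([dimG_ker_quotient_close]). Elementary amenable groups satisfy the Folner
    condition ([elementary_amenable_folner]), so that F can be chosen to make the
    right-hand side as small as desired.

    The existence of P is obtained from the usual minimizing sequence: by the
    parallelogram identity it is Cauchy, hence converges pointwise, and ker A is
    closed under pointwise limits because each equation (A u)(g) = 0 involves
    finitely many values of u ([projection_exists]). *)

Set Implicit Arguments.
Unset Strict Implicit.
Unset Printing Implicit Defensive.

Import Order.TTheory GRing.Theory Num.Theory.
Import numFieldNormedType.Exports.
Local Open Scope classical_set_scope.
Local Open Scope ring_scope.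

(** * The Folner condition *)

(** The number m stands for 1 / epsilon, which keeps the condition within the
    natural numbers. *)
Definition folner (G : groupType) : Prop :=
  forall (s : seq G) (m : nat), exists F : seq G,
    [/\ uniq F, (0 < size F)%N &
        forall h, h \in s ->
          (m * count (fun x => (h * x)%g \notin F) F <= size F)%N].

Lemma folner_exhausted (G : groupType) (F : seq G) :
  (forall x, x \in F) -> folner G.
Proof.
move=> allF s m; exists (undup F); split; first exact: undup_uniq.
  by rewrite -has_predT; apply/hasP; exists 1%g; rewrite ?mem_undup.
move=> h _; rewrite (@eq_count _ _ pred0) ?count_pred0 ?muln0// => x /=.
by rewrite mem_undup allF.
Qed.

Lemma folner_finite (G : groupType) : finite_set [set: G] -> folner G.
Proof.
move=> finG; apply: (@folner_exhausted _ (fset_set [set: G])) => x.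
by rewrite in_fset_set// inE.
Qed.

Lemma folner_finite_order (G : groupType) (g : G) (k : nat) :
  (0 < k)%N -> (g ^+ k)%g = 1%g ->
  (forall x, exists n, x = (g ^+ n)%g \/ x = (g ^- n)%g) -> folner G.
Proof.
move=> k0 gk gen.
apply: (@folner_exhausted _ [seq (g ^+ i)%g | i <- iota 0 k]).
have powF n : (g ^+ n)%g \in [seq (g ^+ i)%g | i <- iota 0 k].
  have -> : (g ^+ n = g ^+ (n %% k))%g.
    by rewrite {1}(divn_eq n k) expgnDr mulnC expgnA gk expg1n mul1g.
  by apply: map_f; rewrite mem_iota /= ltn_pmod.
move=> x; have [n [->//|->]] := gen x.
suff -> : (g ^- n = g ^+ (n * k.-1))%g by [].
apply: (mulgI (g ^+ n)%g).
by rewrite mulgV -expgnDr -mulnS prednK// mulnC expgnA gk expg1n.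
Qed.

Lemma count_iota_ge n L : (count (fun i => L <= n + i) (iota 0 L) <= n)%N.
Proof.
elim: n L => [|n IH] [|L] //.
  rewrite leqn0; apply/eqP; rewrite -[RHS](count_pred0 (iota 0 L.+1)).
  by apply: eq_in_count => i; rewrite mem_iota /=; lia.
rewrite -(addn1 L) iotaD count_cat /= !add0n.
have := IH L; rewrite (@eq_count _ (fun i => L + 1 <= n.+1 + i)%N
  (fun i => L <= n + i)%N); last by move=> i /=; lia.
by move=> hc; rewrite addn0 -[n.+1]addn1 leq_add// leq_b1.
Qed.

Lemma count_iota_lt n L : (count (fun i => i < n) (iota 0 L) <= n)%N.
Proof.
rewrite -size_filter -[leqRHS](size_iota 0 n); apply: uniq_leq_size.
  by rewrite filter_uniq ?iota_uniq.
by move=> i; rewrite mem_filter !mem_iota => /andP[].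
Qed.

(** If g has infinite order, F is an interval of powers of g: multiplication by
    the n-th power of g or by its inverse moves at most n elements out of the
    interval, whatever its length. *)
Lemma folner_cyclic (G : groupType) : cyclic_group G -> folner G.
Proof.
move=> [g gen].
have [[k /andP[k0 /eqP gk]]|noorder] :=
    pselect (exists k, (0 < k)%N && ((g ^+ k)%g == 1%g)).
  exact: folner_finite_order k0 gk gen.
have g_inj : injective (fun i => g ^+ i)%g.
  suff wlg i j : (i < j)%N -> (g ^+ i)%g <> (g ^+ j)%g.
    by move=> i j ij; case: (ltngtP i j) => // /wlg; rewrite ij.
  move=> ij; rewrite -(subnKC (ltnW ij)) expgnDr -{1}(mulg1 (g ^+ i)%g).
  move=> /mulgI /esym e; apply: noorder; exists (j - i)%N.
  by rewrite subn_gt0 ij e eqxx.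
have memF i r : ((g ^+ i)%g \in [seq (g ^+ i)%g | i <- r]) = (i \in r).
  exact: (mem_map (g_inj : @injective G nat _)).
move=> s m.
pose ex x := projT1 (cid (gen x)).
have exP x : x = (g ^+ ex x)%g \/ x = (g ^- ex x)%g := projT2 (cid (gen x)).
have [L L0 Lm] : exists2 L, (0 < L)%N & (m * \max_(x <- s) ex x <= L)%N.
  by exists (m * \max_(x <- s) ex x).+1.
exists [seq (g ^+ i)%g | i <- iota 0 L]; split.
- by rewrite (map_inj_uniq g_inj) iota_uniq.
- by rewrite size_map size_iota.
move=> h hs; rewrite size_map size_iota count_map.
apply: (@leq_trans (m * ex h)%N); last first.
  by apply: leq_trans Lm; rewrite leq_mul2l (@leq_bigmax_seq _ s xpredT ex h hs isT) ?orbT.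
rewrite leq_mul2l; apply/orP; right.
have [e|e] := exP h.
  apply: leq_trans (count_iota_ge (ex h) L); apply: sub_count => i /=.
  by rewrite {1}e -expgnDr memF mem_iota /= add0n -leqNgt.
apply: (@leq_trans (count (fun i => i < ex h)%N (iota 0 L))).
  rewrite -!size_filter; apply: uniq_leq_size.
    by rewrite filter_uniq ?iota_uniq.
  move=> i; rewrite !mem_filter mem_iota /= add0n => /andP[+ iL].
  rewrite iL andbT; apply: contraNltn => hi.
  rewrite {1}e -{1}(subnKC hi) expgnDr mulKg memF mem_iota /= add0n.
  exact: leq_ltn_trans (leq_subr _ _) iL.
exact: count_iota_lt.
Qed.

(** The structure {multiplicative G -> H} only records products; that the unit is
    preserved follows by cancellation in H. *)
Lemma multiplicativeV (G H : groupType) (f : {multiplicative G -> H}) (x : G) :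
  f x^-1%g = (f x)^-1%g.
Proof.
have f1 : f 1%g = 1%g.
  by apply: (mulgI (f 1%g)); rewrite -gmulfM !mulg1.
by apply: (mulgI (f x)); rewrite -gmulfM !mulgV.
Qed.

(** With a set-theoretic section sec of p, take F = sec(F_Q) i(F_N). A product
    h sec(q) i(n) equals sec(p(h) q) i(c(h, q) n), so it leaves F only if p(h) q
    leaves F_Q or c(h, q) n leaves F_N. The set F_Q is chosen first, and F_N is
    then chosen for the finitely many elements c(h, q) with q in F_Q. *)
Lemma folner_extension (N E Q : groupType)
    (i : {multiplicative N -> E}) (p : {multiplicative E -> Q}) :
  short_exact i p -> folner N -> folner Q -> folner E.
Proof.
move=> [i_inj p_surj p_ker] folN folQ s m.
pose sec q := projT1 (cid (p_surj q)).
have secK q : p (sec q) = q := projT2 (cid (p_surj q)).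
have [FQ [uFQ FQ0 FQs]] := folQ (map p s) (2 * m)%N.
have cocycle h q : exists n, i n = ((sec (p h * q))^-1 * (h * sec q))%g.
  by apply/p_ker; rewrite gmulfM multiplicativeV gmulfM !secK mulVg.
pose c h q := projT1 (cid (cocycle h q)).
have cP h q : i (c h q) = ((sec (p h * q))^-1 * (h * sec q))%g :=
  projT2 (cid (cocycle h q)).
have [FN [uFN FN0 FNs]] := folN [seq c h q | h <- s, q <- FQ] (2 * m)%N.
have prod_inj q q' n n' : (sec q * i n = sec q' * i n')%g -> (q, n) = (q', n').
  have pin x : p (i x) = 1%g by apply/p_ker; exists x.
  move=> e; have qq : q = q'.
    by have := congr1 p e; rewrite !gmulfM !secK !pin !mulg1.
  by move: e; rewrite qq => /mulgI /i_inj ->.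
exists [seq (sec q * i n)%g | q <- FQ, n <- FN]; split.
- by apply: allpairs_uniq => // -[q n] [q' n'] _ _ /= /prod_inj.
- by rewrite size_allpairs muln_gt0 FQ0.
move=> h hs; rewrite size_allpairs -sum1_count big_mkcond big_allpairs_dep /=.
under eq_bigr do rewrite -big_mkcond sum1_count.
have bad q : (count (fun n => (h * (sec q * i n))%g \notin
      [seq (sec q0 * i n0)%g | q0 <- FQ, n0 <- FN]) FN <=
    ((p h * q)%g \notin FQ) * size FN +
    count (fun n => (c h q * n)%g \notin FN) FN)%N.
  have [phq|_] := boolP ((p h * q)%g \in FQ); last first.
    by rewrite mul1n (leq_trans (count_size _ _))// leq_addr.
  rewrite mul0n add0n; apply: sub_count => n /=; apply: contra => cn.
  apply/allpairsP; exists ((p h * q)%g, (c h q * n)%g); split=> //=.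
  by rewrite gmulfM cP !mulgA mulgV mul1g.
apply: (@leq_trans (m * \sum_(q <- FQ) (((p h * q)%g \notin FQ) * size FN +
    count (fun n => (c h q * n)%g \notin FN) FN))).
  by rewrite leq_mul2l leq_sum ?orbT// => q _; exact: bad.
rewrite big_split /= -big_distrl /=.
have -> : (\sum_(q <- FQ) ((p h * q)%g \notin FQ) =
    count (fun x => (p h * x)%g \notin FQ) FQ)%N.
  by rewrite -sum1_count [RHS]big_mkcond; apply: eq_bigr => q _; case: (_ \notin _).
have hQ := FQs _ (map_f p hs).
have hN : (2 * m * \sum_(q <- FQ) count (fun n => (c h q * n)%g \notin FN) FN
    <= size FQ * size FN)%N.
  have -> : (size FQ * size FN = \sum_(q <- FQ) size FN)%N.
    by rewrite big_const_seq count_predT iter_addn_0 mulnC.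
  rewrite big_distrr /=.
  rewrite !big_seq leq_sum// => q qF; apply: FNs.
  by apply/allpairsP; exists (h, q).
have {}hQ := leq_mul hQ (leqnn (size FN)).
move: hQ hN.
set a := count _ FQ; set b := (\sum_(_ <- _) _)%N; set u := size FQ; set v := size FN.
by clearbody a b u v => *; nia.
Qed.

Lemma folner_directed_union (G : groupType) (I : Type) (H : I -> groupClosed G) :
  directed_union H -> (forall i, folner (subgroup_type (H i))) -> folner G.
Proof.
move=> [dir cover] folH s m.
have [i si] : exists i, {subset s <= H i}.
  elim: s => [|x s [i si]]; first by have [i _] := cover 1%g; exists i.
  have [j xj] := cover x; have [k [ik jk]] := dir i j.
  by exists k => y /[!inE] /predU1P[->|/si /ik//]; exact: jk.
have [F [uF F0 FS]] := folH i (pmap insub s) m.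
exists (map val F); split; rewrite ?size_map//.
  by rewrite (map_inj_uniq val_inj).
move=> h hs; have := FS (Sub h (si h hs)).
rewrite mem_pmap_sub => /(_ hs); rewrite count_map; apply: leq_trans.
rewrite leq_mul2l; apply/orP; right; apply: sub_count => x /=.
apply: contra => hx; apply/mapP; exists (Sub h (si h hs) * x)%g => //.
Qed.

Theorem elementary_amenable_folner (G : groupType) :
  elementary_amenable G -> folner G.
Proof.
elim=> {G}.
- exact: folner_cyclic.
- exact: folner_finite.
- by move=> N E Q i p ex _ fN _; exact: folner_extension ex fN.
- by move=> G I H dirH _; exact: folner_directed_union dirH.
Qed.

(** * Traces of compressions and ranks of subspaces *)

Section TraceRank.
Local Open Scope sesquilinear_scope.
Variables (C : numClosedFieldType) (N : nat).
Implicit Types (M : 'M[C]_N) (v : 'rV[C]_N).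

Definition hform M v : C := (v *m M *m v ^t*) 0 0.

Lemma trmxC_mul m n p (X : 'M[C]_(m, n)) (Y : 'M[C]_(n, p)) :
  (X *m Y) ^t* = Y ^t* *m X ^t*.
Proof. by rewrite trmx_mul map_mxM. Qed.

Lemma mxtrace_hform M m (V : 'M[C]_(m, N)) :
  \tr (V *m M *m V ^t*) = \sum_(i < m) hform M (row i V).
Proof.
rewrite /mxtrace; apply: eq_bigr => i _.
rewrite /hform -row_mul !mxE; apply: eq_bigr => j _.
by rewrite !mxE.
Qed.

Lemma orthonormal_row_base p (W : 'M[C]_(p, N)) :
  exists2 V : 'M[C]_(\rank W, N), V \is unitarymx & (V :=: W)%MS.
Proof.
exists (schmidt (row_base W)).
  by rewrite schmidt_unitarymx// rank_leq_col.
apply: eqmx_trans (eq_row_base W).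
exact/eqmx_schmidt_free/row_base_free.
Qed.

(** Let Q be the orthogonal projection onto the row space of W. Then
    tr M = tr(M Q) + tr((1 - Q) M (1 - Q)), where the first term is the sum of
    the form over an orthonormal basis of W and the second is nonnegative. *)
Lemma mxrank_le_trace M p (W : 'M[C]_(p, N)) :
  (forall v, 0 <= hform M v) ->
  (forall v, (v <= W)%MS -> hform M v = hform 1%:M v) ->
  (\rank W)%:R <= \tr M.
Proof.
move=> M_ge0 M_id; have [V /unitarymxP VV VW] := orthonormal_row_base W.
set Q := V ^t* *m V.
have QQ : Q *m Q = Q by rewrite /Q mulmxA -(mulmxA (V ^t*)) VV mulmx1.
have Qt : Q ^t* = Q by rewrite trmxC_mul trmxCK.
have -> : \tr M = \tr (M *m Q) + \tr (M *m (1%:M - Q)).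
  by rewrite -mxtraceD -mulmxDr subrKC mulmx1.
have -> : \tr (M *m Q) = (\rank W)%:R.
  rewrite mulmxA mxtrace_mulC mulmxA mxtrace_hform.
  under eq_bigr => i _ do rewrite M_id ?(submx_trans (row_sub _ _)) ?VW//.
  by rewrite -mxtrace_hform mulmx1 VV mxtrace1.
rewrite lerDl.
have PP : (1%:M - Q) *m (1%:M - Q) = 1%:M - Q.
  by rewrite mulmxBl mul1mx mulmxBr mulmx1 QQ subrr subr0.
have Pt : (1%:M - Q) ^t* = 1%:M - Q.
  rewrite linearB /= map_mxB Qt; congr (_ - _).
  by rewrite trmx1 map_mx1.
rewrite -PP mulmxA mxtrace_mulC mulmxA -[X in _ *m X]Pt mxtrace_hform.
by rewrite sumr_ge0.
Qed.

(** If the rows of M are in W then M = M Q with Q as above, and tr(M Q) is the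
    sum of the form over an orthonormal basis of W. *)
Lemma trace_le_mxrank M p (W : 'M[C]_(p, N)) :
  (forall v, hform M v <= hform 1%:M v) -> (M <= W)%MS ->
  \tr M <= (\rank W)%:R.
Proof.
move=> M_le1 MW; have [V /unitarymxP VV VW] := orthonormal_row_base W.
have /submxP[X MX] : (M <= V)%MS by rewrite VW.
have -> : M = M *m V ^t* *m V by rewrite {2}MX -(mulmxA X) VV mulmx1.
rewrite mxtrace_mulC mulmxA mxtrace_hform.
apply: (@le_trans _ _ (\sum_i hform 1%:M (row i V))).
  by apply: ler_sum => i _; exact: M_le1.
by rewrite -mxtrace_hform mulmx1 VV mxtrace1.
Qed.

(** The columns of T are linear equations, and M solves those outside b. Each
    equation in b that is given up enlarges the space of solutions by at most
    one dimension. *)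
Lemma kernel_trace_bounds M m (T : 'M[C]_(N, m)) (b : pred 'I_m) :
  (forall v, 0 <= hform M v <= hform 1%:M v) ->
  (forall v, v *m T = 0 -> hform M v = hform 1%:M v) ->
  (forall i j, ~~ b j -> (M *m T) i j = 0) ->
  (N - \rank T)%:R <= \tr M <= (N - \rank T)%:R + #|b|%:R.
Proof.
move=> M01 M_id MT; apply/andP; split.
  rewrite -mxrank_ker; apply: mxrank_le_trace => [v|v /sub_kermxP].
    by have /andP[] := M01 v.
  exact: M_id.
(* T D is T with the columns in b replaced by zero *)
pose D : 'M[C]_m := diag_mx (\row_j (~~ b j)%:R).
have MTD : M *m (T *m D) = 0.
  apply/matrixP => i j; rewrite mulmxA mul_mx_diag !mxE.
  have [bj|/MT Tij] := boolP (b j); first by rewrite mulr0.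
  by have := Tij i; rewrite mxE => ->; rewrite mul0r.
have : \tr M <= (\rank (kermx (T *m D)))%:R.
  apply: trace_le_mxrank; first by move=> v; have /andP[] := M01 v.
  exact/sub_kermxP.
move=> /le_trans; apply.
rewrite -natrD ler_nat mxrank_ker.
suff : (\rank T <= \rank (T *m D) + #|b|)%N by lia.
have {1}-> : T = T *m D + T *m (1%:M - D) by rewrite -mulmxDr subrKC mulmx1.
apply: (leq_trans (mxrank_add _ _)); rewrite leq_add2l.
apply: (leq_trans (mxrankM_maxr _ _)).
(* T - T D has nonzero columns in b only *)
have -> : 1%:M - D = \sum_(j | b j) delta_mx j j.
  have -> : 1%:M - D = diag_mx (\row_j (b j)%:R).
    apply/matrixP => i j; rewrite !mxE; have [_|_] := eqVneq i j.
      by rewrite !mulr1n; case: (b i); rewrite ?subr0 ?subrr.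
    by rewrite !mulr0n subrr.
  rewrite diag_mx_sum_delta [RHS]big_mkcond; apply: eq_bigr => j _.
  by rewrite mxE; case: (b j); rewrite ?scale1r ?scale0r.
rewrite -sum1_card.
apply: (big_ind2 (fun (X : 'M[C]_m) n => \rank X <= n)%N) => [|X x Y y Xx Yy|j _].
- by rewrite mxrank0.
- exact: leq_trans (mxrank_add _ _) (leq_add Xx Yy).
- by rewrite mxrank_delta.
Qed.

End TraceRank.

(** * Unordered sums and square-summable functions *)

Section UnorderedSums.
Variables (R : realType) (T : choiceType).
Local Notation C := (R[i]).
Implicit Types (x y : T -> C) (s t c : C) (J : {fset T}).

(** The epsilon form of convergence along finite subsets keeps partial sums in
    the field R[i], where they can be compared by its order; the topology of
    R[i]^o only enters through [sums_to_sum]. *)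
Definition sums_to x s : Prop := forall e : C, 0 < e ->
  exists A : {fset T}, forall J, (A `<=` J)%fset ->
    `|s - \sum_(g <- J) x g| <= e.

Lemma sums_to_sum x s :
  sums_to x s -> summability.sum (x : T -> R[i]^o) = s.
Proof.
move=> xs; have PF := @summability.totally_filter T.
apply: (@cvg_lim (R[i]^o)); first exact: norm_hausdorff.
apply/(@cvgrPdist_le _ (R[i]^o)) => e e0; have [A AP] := xs e e0.
exists A => // J /= AJ.
by rewrite /summability.partial_sum -(big_seq_fsetE +%R J predT x)/=; exact: AP.
Qed.

Lemma sums_to_uniq x s t : sums_to x s -> sums_to x t -> s = t.
Proof. by move=> /sums_to_sum <- /sums_to_sum. Qed.

Lemma eq_sums_to x y s : x =1 y -> sums_to x s -> sums_to y s.
Proof. by move=> /funext ->. Qed.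

Lemma sums_toD x y s t :
  sums_to x s -> sums_to y t -> sums_to (fun g => x g + y g) (s + t).
Proof.
move=> xs yt e e0; have e20 : 0 < e / 2 by rewrite divr_gt0.
have [A AP] := xs _ e20; have [B BP] := yt _ e20.
exists (A `|` B)%fset => J; rewrite fsubUset => /andP[AJ BJ].
rewrite big_split /= opprD addrACA (le_trans (ler_normD _ _))//.
by rewrite [leRHS](splitr e) lerD ?AP ?BP.
Qed.

Lemma sums_toZ (a : C) x s : sums_to x s -> sums_to (fun g => a * x g) (a * s).
Proof.
move=> xs e e0.
have a1 : 0 < `|a| + 1 by rewrite ltr_wpDl.
have [A AP] := xs _ (divr_gt0 e0 a1).
exists A => J AJ; rewrite -mulr_sumr -mulrBr normrM.
rewrite (le_trans (ler_wpM2l _ (AP J AJ)))//.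
by rewrite mulrCA ler_piMr ?ltW// ltr_pdivrMr// mul1r ltrDl.
Qed.

Lemma sums_to_conj x s : sums_to x s -> sums_to (fun g => (x g)^*%R) s^*%R.
Proof.
move=> xs e e0; have [A AP] := xs _ e0; exists A => J AJ.
by rewrite -rmorph_sum -rmorphB norm_conjC AP.
Qed.

Lemma sum_fset_le x (A J : {fset T}) :
  (forall g, 0 <= x g) -> (A `<=` J)%fset ->
  \sum_(g <- A) x g <= \sum_(g <- J) x g.
Proof.
move=> x0 AJ; pose y g := if g \in A then x g else 0.
have -> : \sum_(g <- A) x g = \sum_(g <- A) y g.
  by rewrite big_seq [RHS]big_seq; apply: eq_bigr => g gA; rewrite /y gA.
rewrite (big_fset_incl _ AJ) => [|g _ /negPf]; last by rewrite /y => ->.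
by apply: ler_sum => g _; rewrite /y; case: ifP.
Qed.

(** The sum is the supremum of the finite partial sums, which increase with the
    finite set and are bounded by hypothesis. *)
Lemma sums_to_nneg x (M : C) :
  (forall g, 0 <= x g) -> (forall J, \sum_(g <- J) x g <= M) ->
  exists s, [/\ sums_to x s, forall J, \sum_(g <- J) x g <= s &
    forall c, (forall J, \sum_(g <- J) x g <= c) -> s <= c].
Proof.
move=> x0 xM.
pose S J := \sum_(g <- J) x g.
have S0 J : 0 <= S J by rewrite sumr_ge0.
have SE J : S J = (complex.Re (S J))%:C%C by rewrite RRe_real ?ger0_real.
pose E := [set complex.Re (S J) | J in [set: {fset T}]].
have supE : has_sup E.
  split; first by exists (complex.Re (S fset0)), fset0.
  by exists (complex.Re M) => _ [J _ <-]; have := xM J; rewrite lecE => /andP[].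
have Sub J : S J <= (sup E)%:C%C.
  by rewrite SE lecR; apply: sup_ubound; [exact: supE.2 | exists J].
exists (sup E)%:C%C; split=> // [e e0|c Sc]; last first.
  have cR : c = (complex.Re c)%:C%C.
    by rewrite RRe_real// ger0_real// (le_trans (S0 fset0) (Sc fset0)).
  rewrite cR lecR; apply: ge_sup; first exact: supE.1.
  by move=> _ [J _ <-]; have := Sc J; rewrite -/(S J) SE cR lecR.
have eR : e = (complex.Re e)%:C%C by rewrite RRe_real// gtr0_real.
have e0R : 0 < complex.Re e by rewrite -ltcR -eR.
have [_ [A _ <-] eA] := sup_adherent e0R supE.
exists A => J AJ; rewrite ger0_norm ?subr_ge0 ?Sub//.
rewrite lerBlDl -lerBlDr.
apply: (@le_trans _ _ (S A)).
  by rewrite [S A]SE eR -rmorphB lecR (ltW eA).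
exact: (sum_fset_le x0 AJ).
Qed.

Lemma sums_to_finite x (A : {fset T}) :
  (forall g, g \notin A -> x g = 0) -> sums_to x (\sum_(g <- A) x g).
Proof.
move=> x0 e e0; exists A => J AJ.
rewrite (big_fset_incl _ AJ) => [|g _ /x0//].
by rewrite subrr normr0 ltW.
Qed.

Lemma sums_to_sumr n (x : 'I_n -> T -> C) (s : 'I_n -> C) :
  (forall i, sums_to (x i) (s i)) ->
  sums_to (fun g => \sum_i x i g) (\sum_i s i).
Proof.
move=> xs; elim: (index_enum _) => [|i r IH].
  rewrite big_nil -[X in sums_to _ X](@big_nil _ 0 +%R T predT (fun _ => 0)).
  apply: (@eq_sums_to (fun _ => 0)) => [g|]; first by rewrite big_nil.
  exact: (@sums_to_finite (fun _ => 0) fset0).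
rewrite big_cons; apply: eq_sums_to (sums_toD (xs i) IH) => g.
by rewrite big_cons.
Qed.

End UnorderedSums.

Section SquareSummable.
Variables (R : realType) (G : groupType).
Local Notation C := (R[i]).
Implicit Types (f h : G -> C).

Lemma sums_to_translate (x : G -> C) s (t : G) :
  sums_to x s -> sums_to (fun g => x (g * t)%g) s.
Proof.
move=> xs e e0; have [A AP] := xs e e0.
exists [fset (g * t^-1)%g | g in A]%fset => J AJ.
have -> : \sum_(g <- J) x (g * t)%g =
    \sum_(g <- [fset (g * t)%g | g in J]%fset) x g.
  by rewrite big_imfset//= => g g' _ _ /mulIg.
apply: AP; apply/fsubsetP => g gA; apply/imfsetP; exists (g * t^-1)%g => /=.
  by apply/(fsubsetP AJ)/imfsetP; exists g.
by rewrite mulgVK.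
Qed.

(** All later estimates only use bounds of finite partial sums. *)
Lemma l2P f : l2 f <->
  exists M : C, forall J : {fset G}, \sum_(g <- J) `|f g| ^+ 2 <= M.
Proof.
have norm2 g : `|f g| ^+ 2 = ((complex.Re `|f g|) ^+ 2)%:C%C.
  by rewrite -[in LHS](RRe_real (normr_real (f g))) -rmorphXn.
split.
  rewrite /l2 /= => fin.
  have esum0 : (0 <= \esum_(g in [set: G]) (complex.Re `|f g| ^+ 2)%:E)%E.
    by apply: esum_ge0 => g _; rewrite lee_fin sqr_ge0.
  exists (fine (\esum_(g in [set: G]) (complex.Re `|f g| ^+ 2)%:E)%E)%:C%C => J.
  under eq_bigr do rewrite norm2.
  rewrite -rmorph_sum lecR -lee_fin fineK ?ge0_fin_numE//.
  apply: esum_ge; exists [set` J]; first by split.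
  by rewrite fsbig_finite//= set_fsetK sumEFin.
move=> [M MP]; apply: (@le_lt_trans _ _ (complex.Re M)%:E); last by rewrite ltry.
apply: ub_ereal_sup => _ [X [finX _] <-].
rewrite fsbig_finite//= sumEFin lee_fin.
have := MP (fset_set X); under eq_bigr do rewrite norm2.
by rewrite -rmorph_sum lecE => /andP[].
Qed.

Lemma normD_sqr_le (x y : C) : `|x + y| ^+ 2 <= 2 * `|x| ^+ 2 + 2 * `|y| ^+ 2.
Proof.
have -> : 2 * `|x| ^+ 2 + 2 * `|y| ^+ 2 = `|x + y| ^+ 2 + `|x - y| ^+ 2.
  by rewrite !normCK rmorphB rmorphD /=; ring.
by rewrite lerDl exprn_ge0.
Qed.

Lemma l2_lin (a : C) f h : l2 f -> l2 h -> l2 (fun g => a * f g + h g).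
Proof.
move=> /l2P[M MP] /l2P[M' MP']; apply/l2P.
exists (2 * (`|a| ^+ 2 * M) + 2 * M') => J.
apply: (@le_trans _ _
    (\sum_(g <- J) (2 * (`|a| ^+ 2 * `|f g| ^+ 2) + 2 * `|h g| ^+ 2))).
  apply: ler_sum => g _; rewrite (le_trans (normD_sqr_le _ _))//.
  by rewrite normrM exprMn.
rewrite big_split /= -!mulr_sumr lerD// ler_pM2l// ?MP'//.
by rewrite ler_wpM2l ?exprn_ge0.
Qed.

Lemma l2_norm_sums f : l2 f ->
  exists s, sums_to (fun g => `|f g| ^+ 2) s.
Proof.
move=> /l2P[M MP]; have [|s [fs _ _]] := sums_to_nneg _ MP; last by exists s.
by move=> g; rewrite exprn_ge0.
Qed.

(** By polarization, f h^* is a combination of four functions |a h + f|^2,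
    each of which has an unordered sum because it is nonnegative. *)
Lemma l2_inner_sums f h : l2 f -> l2 h ->
  sums_to (fun g => f g * (h g)^*%R) (l2_inner f h).
Proof.
move=> lf lh.
suff [s fs] : exists s, sums_to (fun g => f g * (h g)^*%R) s.
  by rewrite [X in sums_to _ X](_ : _ = s)//; exact: sums_to_sum fs.
have pol (a : C) : exists s, sums_to (fun g => `|a * h g + f g| ^+ 2) s.
  exact: l2_norm_sums (l2_lin a lh lf).
have [s1 S1] := pol 1; have [s2 S2] := pol (-1).
have [s3 S3] := pol 'i; have [s4 S4] := pol (- 'i).
exists (4^-1 * (s1 + (-1) * s2 + ('i * s3 + (- 'i) * s4))).
apply: eq_sums_to (sums_toZ 4^-1 (sums_toD (sums_toD S1 (sums_toZ (-1) S2))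
  (sums_toD (sums_toZ 'i S3) (sums_toZ (- 'i) S4)))) => g.
have ii : 'i * 'i = -1 :> C by rewrite -expr2 sqrCi.
rewrite !normCK !rmorphD !rmorphM !rmorphN /= conjCi rmorph1.
set x := f g; set y' := _^*%R; set y := h g; set x' := _^*%R.
by field: ii.
Qed.

End SquareSummable.

(** * The Hilbert space of vectors of square-summable functions *)

Section HilbertSpace.
Variables (R : realType) (G : groupType) (d : nat).
Local Notation C := (R[i]).
Local Notation vec := ('I_d -> G -> C).
Implicit Types (u v w : vec) (K : set vec).

(** A single operation that covers sums, differences and scalings of vectors. *)
Definition lin (a : C) u v : vec := fun i g => a * u i g + v i g.

Definition delta (t : 'I_d * G) : vec :=
  fun i g => if (i == t.1) && (g == t.2) then 1 else 0.

Lemma l2d_lin a u v : l2d u -> l2d v -> l2d (lin a u v).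
Proof. by move=> lu lv i; exact: l2_lin (lu i) (lv i). Qed.

Lemma l2d_inner_sums u v : l2d u -> l2d v ->
  sums_to (fun g => \sum_i u i g * (v i g)^*%R) (l2d_inner u v).
Proof. by move=> lu lv; apply: sums_to_sumr => i; exact: l2_inner_sums. Qed.

Lemma l2d_inner_lin a u v w : l2d u -> l2d v -> l2d w ->
  l2d_inner (lin a u v) w = a * l2d_inner u w + l2d_inner v w.
Proof.
move=> lu lv lw; apply: sums_to_uniq (l2d_inner_sums (l2d_lin a lu lv) lw) _.
apply: eq_sums_to (sums_toD (sums_toZ a (l2d_inner_sums lu lw))
  (l2d_inner_sums lv lw)) => g.
rewrite mulr_sumr -big_split; apply: eq_bigr => i _ /=.
by rewrite /lin mulrDl mulrA.
Qed.

Lemma l2d_inner_conj u v : l2d u -> l2d v ->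
  l2d_inner v u = (l2d_inner u v)^*%R.
Proof.
move=> lu lv; apply: sums_to_uniq (l2d_inner_sums lv lu) _.
apply: eq_sums_to (sums_to_conj (l2d_inner_sums lu lv)) => g.
rewrite rmorph_sum; apply: eq_bigr => i _.
by rewrite rmorphM /= conjCK mulrC.
Qed.

Lemma l2d_inner_linr a u v w : l2d u -> l2d v -> l2d w ->
  l2d_inner w (lin a u v) = a^*%R * l2d_inner w u + l2d_inner w v.
Proof.
move=> lu lv lw; rewrite (l2d_inner_conj (l2d_lin a lu lv) lw).
by rewrite l2d_inner_lin// rmorphD rmorphM /= -!l2d_inner_conj.
Qed.

Lemma l2d_norm_sums u : l2d u ->
  sums_to (fun g => \sum_i `|u i g| ^+ 2) (l2d_inner u u).
Proof.
move=> lu; apply: eq_sums_to (l2d_inner_sums lu lu) => g.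
by apply: eq_bigr => i _; rewrite normCK.
Qed.

Lemma l2d_sub_norm u (M : C) :
  (forall J : {fset G}, \sum_(g <- J) \sum_i `|u i g| ^+ 2 <= M) -> l2d u.
Proof.
move=> uM i; apply/l2P; exists M => J; apply: le_trans (uM J).
by apply: ler_sum => g _; rewrite (bigD1 i)//= lerDl sumr_ge0.
Qed.

(** The squared norm is a least upper bound of finite sums; this makes it
    lower semicontinuous for pointwise convergence. *)
Lemma l2d_norm_lub u : l2d u ->
  (forall J : {fset G}, \sum_(g <- J) \sum_i `|u i g| ^+ 2 <= l2d_inner u u) /\
  (forall c : C, (forall J : {fset G}, \sum_(g <- J) \sum_i `|u i g| ^+ 2 <= c) ->
    l2d_inner u u <= c).
Proof.
move=> lu; have us := l2d_norm_sums lu.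
have u0 g : 0 <= \sum_i `|u i g| ^+ 2 by rewrite sumr_ge0.
have [M uM] : exists M : C,
    forall J : {fset G}, \sum_(g <- J) \sum_i `|u i g| ^+ 2 <= M.
  exists (\sum_i projT1 (cid ((l2P (u i)).1 (lu i)))) => J.
  rewrite exchange_big; apply: ler_sum => i _.
  exact: projT2 (cid ((l2P (u i)).1 (lu i))) J.
have [s [us' ub lub]] := sums_to_nneg u0 uM.
by rewrite (sums_to_uniq us us').
Qed.

Lemma l2d_inner_ge0 u : l2d u -> 0 <= l2d_inner u u.
Proof.
by move=> /l2d_norm_lub[/(_ fset0)]; rewrite big_seq_fset0.
Qed.

Lemma l2d_coord_le u i g : l2d u -> `|u i g| ^+ 2 <= l2d_inner u u.
Proof.
move=> /l2d_norm_lub[/(_ [fset g]%fset) + _]; apply: le_trans.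
by rewrite big_seq_fset1 (bigD1 i)//= lerDl sumr_ge0.
Qed.

Lemma l2d_delta t : l2d (delta t).
Proof.
apply: (@l2d_sub_norm _ 1) => J.
have z g : g \notin [fset t.2]%fset -> \sum_i `|delta t i g| ^+ 2 = 0.
  rewrite in_fset1 => /negPf gt; rewrite big1// => i _.
  by rewrite /delta gt andbF normr0 expr0n.
have p g : 0 <= \sum_i `|delta t i g| ^+ 2.
  by rewrite sumr_ge0.
apply: (@le_trans _ _ (\sum_(g <- [fset t.2]%fset) \sum_i `|delta t i g| ^+ 2)).
  apply: (le_trans (sum_fset_le p (fsubsetUl J [fset t.2]%fset))).
  by rewrite -(big_fset_incl _ (fsubsetUr J [fset t.2]%fset)) => [//|g _ /z].
rewrite big_seq_fset1 (bigD1 t.1)//= big1 => [|i /negPf it].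
  by rewrite addr0 /delta !eqxx normr1 expr1n.
by rewrite /delta it normr0 expr0n.
Qed.

Lemma l2d_inner_delta u t : l2d u -> l2d_inner u (delta t) = u t.1 t.2.
Proof.
move=> lu; apply: sums_to_uniq (l2d_inner_sums lu (l2d_delta t)) _.
set x := fun g => _.
have -> : u t.1 t.2 = \sum_(g <- [fset t.2]%fset) x g.
  rewrite big_seq_fset1 /x (bigD1 t.1)//= big1 => [|i /negPf it].
    by rewrite /delta !eqxx rmorph1 mulr1 addr0.
  by rewrite /delta it rmorph0 mulr0.
apply: sums_to_finite => g; rewrite in_fset1 => /negPf gt.
by rewrite /x big1// => i _; rewrite /delta gt andbF rmorph0 mulr0.
Qed.

Definition translate (t : G) u : vec := fun i g => u i (g * t)%g.

Lemma l2d_translate t u : l2d u -> l2d (translate t u).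
Proof.
move=> lu; have [ub _] := l2d_norm_lub lu.
apply: (@l2d_sub_norm _ (l2d_inner u u)) => J.
have -> : \sum_(g <- J) \sum_i `|translate t u i g| ^+ 2 =
    \sum_(g <- [fset (g * t)%g | g in J]%fset) \sum_i `|u i g| ^+ 2.
  by rewrite big_imfset//= => g g' _ _ /mulIg.
exact: ub.
Qed.

Lemma l2d_inner_translate t u v : l2d u -> l2d v ->
  l2d_inner (translate t u) (translate t v) = l2d_inner u v.
Proof.
move=> lu lv.
apply: sums_to_uniq (l2d_inner_sums (l2d_translate t lu) (l2d_translate t lv)) _.
exact: (sums_to_translate t (l2d_inner_sums lu lv)).
Qed.

Definition subspace K : Prop :=
  K (fun _ _ => 0) /\ forall a u v, K u -> K v -> K (lin a u v).

Lemma subspace_l2d : subspace (@l2d R G d).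
Proof.
split; last by move=> *; exact: l2d_lin.
by apply: (@l2d_sub_norm _ 0) => J; rewrite big1// => g _; rewrite big1// => i _;
  rewrite normr0 expr0n.
Qed.

Definition comb (I : Type) (r : seq I) (x : I -> C) (e : I -> vec) : vec :=
  fun i g => \sum_(a <- r) x a * e a i g.

Lemma comb_cons I (b : I) r x e : comb (b :: r) x e = lin (x b) (e b) (comb r x e).
Proof. by apply/funext => i; apply/funext => g; rewrite /comb big_cons. Qed.

Lemma comb_nil I x (e : I -> vec) : comb [::] x e = fun _ _ => 0.
Proof. by apply/funext => i; apply/funext => g; rewrite /comb big_nil. Qed.

Lemma subspace_comb K (I : Type) (r : seq I) x e :
  subspace K -> (forall a, K (e a)) -> K (comb r x e).
Proof.
move=> [K0 Klin] Ke; elim: r => [|b r IH]; first by rewrite comb_nil.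
by rewrite comb_cons; exact: Klin.
Qed.

Lemma l2d_inner0 w : l2d w -> l2d_inner (fun _ _ => 0) w = 0.
Proof.
move=> lw; have l0 := subspace_l2d.1.
have -> : (fun _ _ => 0) = lin (-1) (fun _ _ => 0) (fun _ _ => 0) :> vec.
  by apply/funext => i; apply/funext => g; rewrite /lin mulr0 addr0.
by rewrite l2d_inner_lin// mulN1r addNr.
Qed.

Lemma l2d_inner_comb (I : Type) (r : seq I) x e w :
  (forall a, l2d (e a)) -> l2d w ->
  l2d_inner (comb r x e) w = \sum_(a <- r) x a * l2d_inner (e a) w.
Proof.
move=> le lw; elim: r => [|b r IH].
  by rewrite comb_nil big_nil l2d_inner0.
rewrite comb_cons l2d_inner_lin//; last exact: subspace_comb subspace_l2d _.
by rewrite big_cons IH.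
Qed.

End HilbertSpace.

(** * Orthogonal projections *)

Section Projection.
Variables (R : realType) (G : groupType) (d : nat).
Local Notation C := (R[i]).
Local Notation vec := ('I_d -> G -> C).
Implicit Types (u v w x y k : vec) (K : set vec).
Local Notation ip := (@l2d_inner R G d).

(** The rate is the one of the coordinates of a minimizing sequence whose n-th
    term is within 1 / (n + 1) of the infimum. *)
Lemma cauchy_rate_cvg (a : nat -> R) :
  (forall n m, (a n - a m) ^+ 2 <= 2 * (n.+1%:R^-1 + m.+1%:R^-1)) ->
  exists l : R, a n @[n --> \oo] --> l.
Proof.
move=> aC; suff /cvg_ex[l al] : cvgn a by exists l.
apply/cauchy_cvgP; apply: cauchy_exP => e e0.
have e40 : 0 < e ^+ 2 / 4 by rewrite divr_gt0 ?exprn_gt0.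
have [n0 _ nP] := near_infty_natSinv_lt (PosNum e40).
exists (a n0); exists n0 => // n n0n; rewrite /ball /=.
rewrite -ltr_sqr ?nnegrE ?normr_ge0 ?(ltW e0)// real_normK ?num_real//.
have h1 : n0.+1%:R^-1 < e ^+ 2 / 4 := nP n0 (leqnn _).
have h2 : n.+1%:R^-1 < e ^+ 2 / 4 := nP n n0n.
apply: le_lt_trans (aC n0 n) _; move: h1 h2.
by move: (n0.+1%:R^-1) (n.+1%:R^-1) => b c; lra.
Qed.

Lemma cvg_Re_Im (z : nat -> C) (l : C) :
  complex.Re (z n) @[n --> \oo] --> complex.Re l ->
  complex.Im (z n) @[n --> \oo] --> complex.Im l ->
  (z n : R[i]^o) @[n --> \oo] --> (l : R[i]^o).
Proof.
move=> /cvgrPdist_le zr /cvgrPdist_le zi.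
apply/(@cvgrPdist_le _ (R[i]^o)) => e e0.
have eR : e = (complex.Re e)%:C%C by rewrite RRe_real// gtr0_real.
have e20 : 0 < complex.Re e / 2 by rewrite divr_gt0// -ltcR -eR.
near=> n.
have h1 : `|complex.Re l - complex.Re (z n)| <= complex.Re e / 2.
  by near: n; exact: zr.
have h2 : `|complex.Im l - complex.Im (z n)| <= complex.Re e / 2.
  by near: n; exact: zi.
have cn (x : R) : `|x%:C%C| = `|x|%:C%C by rewrite normc_def /= expr0n addr0 sqrtr_sqr.
have cni : `|'i%C| = 1 :> C by rewrite normc_def /= expr0n add0r expr1n sqrtr1.
rewrite [l - z n]complexE (le_trans (ler_normD _ _))// normrM cni mul1r !cn.
rewrite -rmorphD eR lecR [leRHS]splitr.
by case: (l) (z n) h1 h2 => l1 l2 [z1 z2] /= h1 h2; rewrite lerD.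
Unshelve. all: end_near.
Qed.

Definition sqn (z : C) : R := complex.Re z ^+ 2 + complex.Im z ^+ 2.

Lemma norm_sqn (z : C) : `|z| ^+ 2 = (sqn z)%:C%C.
Proof. by rewrite -add_Re2_Im2. Qed.

Definition nrm u : R := complex.Re (ip u u).

Lemma nrmE u : l2d u -> ip u u = (nrm u)%:C%C.
Proof. by move=> lu; rewrite RRe_real// ger0_real// l2d_inner_ge0. Qed.

Lemma nrm_ge0 u : l2d u -> 0 <= nrm u.
Proof. by move=> lu; rewrite -lecR -nrmE// l2d_inner_ge0. Qed.

Lemma inner_lin_lin (a : C) x y : l2d x -> l2d y ->
  ip (lin a x y) (lin a x y) =
  a * a^*%R * ip x x + a * ip x y + a^*%R * ip y x + ip y y.
Proof.
move=> lx ly; have lxy := l2d_lin a lx ly.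
rewrite l2d_inner_lin// !l2d_inner_linr//; ring.
Qed.

Lemma parallelogram x y : l2d x -> l2d y ->
  ip (lin (-1) x y) (lin (-1) x y) =
  2 * ip x x + 2 * ip y y - ip (lin 1 x y) (lin 1 x y).
Proof.
move=> lx ly; rewrite !inner_lin_lin// rmorphN rmorph1; ring.
Qed.

Lemma sub_lin u v : (fun i g => u i g - v i g) = lin (-1) v u :> vec.
Proof.
by apply/funext => i; apply/funext => g; rewrite /lin mulN1r addrC.
Qed.

Definition pointwise_closed K := forall (un : nat -> vec) p,
  (forall n, K (un n)) -> l2d p ->
  (forall i g, (un n i g : R[i]^o) @[n --> \oo] --> (p i g : R[i]^o)) -> K p.

Variables (K : set vec) (u : vec).
Hypotheses (subK : subspace K) (Kl2 : K `<=` @l2d R G d)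
  (closedK : pointwise_closed K) (lu : l2d u).

Let dist k := nrm (lin (-1) k u).

Let l2d_diff k : K k -> l2d (lin (-1) k u).
Proof. by move=> /Kl2 lk; exact: l2d_lin. Qed.

(** A minimizing sequence for the distance to u is Cauchy by the parallelogram
    identity, hence converges pointwise to some p. Every finite partial sum of
    |u - p|^2 is at most the infimum, since it is a limit of partial sums of
    |u - k_n|^2; hence so is the norm of u - p, which gives both that p is
    square-summable and that it is minimal. *)
Lemma minimizer_exists : exists p, K p /\ forall k, K k -> dist p <= dist k.
Proof.
pose E := [set dist k | k in K].
have E0 : E !=set0 by exists (dist (fun _ _ => 0)), (fun _ _ => 0); first exact: subK.1.
have lbE : lbound E 0 by move=> _ [k Kk <-]; exact/nrm_ge0/l2d_diff.
have infE : has_inf E by split; [exact: E0 | exists 0].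
have infP k : K k -> inf E <= dist k.
  by move=> Kk; apply: ge_inf; [exists 0 | exists k].
have close n : exists k, K k /\ dist k < inf E + n.+1%:R^-1.
  have n0 : 0 < n.+1%:R^-1 :> R by rewrite invr_gt0.
  by have [_ [k Kk <-] kE] := inf_adherent n0 infE; exists k.
pose kn n := projT1 (cid (close n)).
have Kkn n : K (kn n) := (projT2 (cid (close n))).1.
have knE n : dist (kn n) < inf E + n.+1%:R^-1 := (projT2 (cid (close n))).2.
have pl n m : nrm (lin (-1) (kn m) (kn n)) <= 2 * (n.+1%:R^-1 + m.+1%:R^-1).
  set x := lin (-1) (kn n) u; set y := lin (-1) (kn m) u.
  have lx : l2d x by exact: l2d_diff.
  have ly : l2d y by exact: l2d_diff.
  pose z : vec := fun _ _ => 0.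
  pose mid := lin (2^-1) (lin 1 (kn n) (kn m)) z.
  have Kmid : K mid by exact: (subK.2 _ _ _ (subK.2 _ _ _ (Kkn n) (Kkn m)) subK.1).
  have xyE : lin (-1) x y = lin (-1) (kn m) (kn n).
    by apply/funext => i; apply/funext => g; rewrite /x /y /lin; ring.
  have midE : lin 1 x y = lin 2 (lin (-1) mid u) z.
    by apply/funext => i; apply/funext => g; rewrite /x /y /mid /z /lin; field.
  have lz : l2d z by exact: (subspace_l2d R G d).1.
  have := parallelogram lx ly; rewrite xyE midE.
  rewrite (nrmE lx) (nrmE ly) (inner_lin_lin 2 (l2d_diff Kmid) lz).
  have lk := l2d_lin (-1) (Kl2 (Kkn m)) (Kl2 (Kkn n)).
  rewrite (nrmE lk) (nrmE (l2d_diff Kmid)) (l2d_inner_conj lz (l2d_diff Kmid)).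
  rewrite (l2d_inner0 (l2d_diff Kmid)) (l2d_inner0 lz) conjC0 conjC_nat => eqC.
  have -> : nrm (lin (-1) (kn m) (kn n)) =
      2 * nrm x + 2 * nrm y - 4 * nrm (lin (-1) mid u).
    apply: (fmorph_inj (real_complex R)).
    rewrite rmorphB rmorphD !rmorphM !rmorph_nat.
    by apply: etrans eqC _; ring.
  have h1 : inf E <= nrm (lin (-1) mid u) := infP _ Kmid.
  have h2 : nrm x < inf E + n.+1%:R^-1 := knE n.
  have h3 : nrm y < inf E + m.+1%:R^-1 := knE m.
  by move: h2 h3; move: (n.+1%:R^-1) (m.+1%:R^-1) => b c; lra.
have coord n m i g : sqn (kn n i g - kn m i g) <= 2 * (n.+1%:R^-1 + m.+1%:R^-1).
  apply: le_trans (pl n m); rewrite -lecR -norm_sqn.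
  have lk := l2d_lin (-1) (Kl2 (Kkn m)) (Kl2 (Kkn n)).
  rewrite -(nrmE lk); have := l2d_coord_le i g lk.
  by rewrite {1}/lin mulN1r addrC.
have cvRe i g : exists l : R, complex.Re (kn n i g) @[n --> \oo] --> l.
  apply: cauchy_rate_cvg => n m; apply: le_trans (coord n m i g).
  by rewrite /sqn; case: (kn n i g) (kn m i g) => a b [a' b'] /=; rewrite lerDl sqr_ge0.
have cvIm i g : exists l : R, complex.Im (kn n i g) @[n --> \oo] --> l.
  apply: cauchy_rate_cvg => n m; apply: le_trans (coord n m i g).
  by rewrite /sqn; case: (kn n i g) (kn m i g) => a b [a' b'] /=; rewrite lerDr sqr_ge0.
pose p : vec := fun i g =>
  Complex (projT1 (cid (cvRe i g))) (projT1 (cid (cvIm i g))).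
have pRe i g : complex.Re (kn n i g) @[n --> \oo] --> complex.Re (p i g).
  exact: projT2 (cid (cvRe i g)).
have pIm i g : complex.Im (kn n i g) @[n --> \oo] --> complex.Im (p i g).
  exact: projT2 (cid (cvIm i g)).
have bound (J : {fset G}) :
    \sum_(g <- J) \sum_i `|lin (-1) p u i g| ^+ 2 <= (inf E)%:C%C.
  under eq_bigr do under eq_bigr do rewrite norm_sqn.
  under eq_bigr do rewrite -rmorph_sum.
  rewrite -rmorph_sum lecR.
  apply: (@ler_cvg_to _ \oo _ _
    (fun n => \sum_(g <- J) \sum_i sqn (lin (-1) (kn n) u i g))
    (fun n => inf E + n.+1%:R^-1)).
  - apply: cvg_big => [|g _]; first exact: add_continuous.
    apply: cvg_big => [|i _]; first exact: add_continuous.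
    have sqnE v : sqn (lin (-1) v u i g) =
        (complex.Re (u i g) - complex.Re (v i g)) ^+ 2 +
        (complex.Im (u i g) - complex.Im (v i g)) ^+ 2.
      rewrite /sqn /lin mulN1r [_ + u i g]addrC.
      by case: (u i g) (v i g) => a b [a' b'].
    rewrite sqnE; under eq_fun do rewrite sqnE.
    have sq2 (z : nat -> R) (l b : R) : z n @[n --> \oo] --> l ->
        (b - z n) ^+ 2 @[n --> \oo] --> (b - l) ^+ 2.
      move=> zl; have bz : b - z n @[n --> \oo] --> b - l.
        by apply: cvgB zl; exact: cvg_cst.
      exact: (cvgM bz bz).
    by apply: cvgD; apply: sq2.
  - rewrite -[X in _ --> X]addr0; apply: cvgD; first exact: cvg_cst.
    exact: cvg_harmonic.
  - near=> n; rewrite -lecR.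
    apply: (@le_trans _ _ (ip (lin (-1) (kn n) u) (lin (-1) (kn n) u))).
      apply: le_trans ((l2d_norm_lub (l2d_diff (Kkn n))).1 J).
      rewrite rmorph_sum ler_sum// => g _; rewrite rmorph_sum ler_sum// => i _.
      by rewrite norm_sqn.
    by rewrite (nrmE (l2d_diff (Kkn n))) lecR (ltW (knE n)).
have le : l2d (lin (-1) p u) := l2d_sub_norm bound.
have lp : l2d p.
  have -> : p = lin (-1) (lin (-1) p u) u.
    by apply/funext => i; apply/funext => g; rewrite /lin; ring.
  exact: l2d_lin.
exists p; split; first by apply: closedK Kkn lp _ => i g; exact: cvg_Re_Im.
move=> k /infP; apply: le_trans; rewrite -lecR -nrmE//.
exact: (l2d_norm_lub le).2.
Unshelve. all: end_near.
Qed.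

(** If z = <u - p, w> were nonzero, moving p by s z w with
    s = 1 / (|w|^2 + 1) would decrease the distance to u. *)
Theorem projection_exists : exists p, is_orthogonal_projection K u p.
Proof.
have [p [Kp pmin]] := minimizer_exists.
exists p; split=> // w Kw; rewrite sub_lin.
set e := lin (-1) p u.
have le : l2d e by exact: l2d_diff.
have lw := Kl2 Kw.
apply/eqP; apply: contraT => z0.
have W0 := l2d_inner_ge0 lw.
set s := (ip w w + 1)^-1.
have s0 : 0 < s by rewrite invr_gt0 ltr_wpDl.
pose a := s * ip e w.
have := pmin _ (subK.2 a _ _ Kw Kp).
have -> : dist (lin a w p) = nrm (lin (- a) w e).
  rewrite /dist; congr nrm.
  by apply/funext => i; apply/funext => g; rewrite /e /lin; ring.
rewrite /dist -/e -lecR -(nrmE le) -(nrmE (l2d_lin (- a) lw le)) inner_lin_lin// lerDr.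
rewrite (l2d_inner_conj le lw) rmorphN rmorphM /= (geC0_conj (ltW s0)).
have -> : - (s * ip e w) * - (s * (ip e w)^*%R) * ip w w +
    - (s * ip e w) * (ip e w)^*%R + - (s * (ip e w)^*%R) * ip e w =
    s * `|ip e w| ^+ 2 * (s * ip w w - 2).
  by rewrite normCK; ring.
rewrite pmulr_rge0; last by rewrite mulr_gt0// exprn_gt0// normr_gt0.
have : s * ip w w <= 1.
  by rewrite mulrC ler_pdivrMr ?ltr_wpDl// mul1r lerDl.
by move=> h1; rewrite subr_ge0 => /le_trans/(_ h1); rewrite (ler_nat _ 2 1).
Qed.

End Projection.

(** * The kernel of a matrix over the group algebra *)

Section Convolution.
Variables (R : realType) (G : groupType).
Local Notation C := (R[i]).

(** The values of the convolution at g only depend on the values of f on F as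
    soon as, for h in the support of a, f vanishes at those points h^-1 g that
    are outside F. This covers both a function supported on F and any function
    at an interior point g. *)
Lemma convolution_window (a : group_algebra R G) (f : G -> C) n (F : 'I_n -> G) g :
  injective F ->
  (forall h, h \in finsupp a -> (exists x, (h^-1 * g)%g = F x) \/ f (h^-1 * g)%g = 0) ->
  convolution a f g = \sum_x a (g * (F x)^-1)%g * f (F x) :> C.
Proof.
move=> F_inj supp.
have FhE h x : (h == g * (F x)^-1)%g = (F x == h^-1 * g)%g.
  apply/eqP/eqP => [->|->].
    by rewrite invgM invgK mulgVK.
  by rewrite invgM invgK mulgA mulgV mul1g.
pose t x h : C := if (h == g * (F x)^-1)%g then a h * f (F x) else 0.
transitivity (\sum_(h <- finsupp a) \sum_x t x h).
  rewrite /convolution big_seq [RHS]big_seq; apply: eq_bigr => h /supp[[x0 hx0]|f0].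
    rewrite (bigD1 x0)//= big1 ?addr0 => [|x xx0].
      by rewrite /t FhE hx0 eqxx.
    by rewrite /t FhE hx0 (inj_eq F_inj) (negPf xx0).
  rewrite f0 mulr0 big1// => x _; rewrite /t FhE.
  by case: eqP => // ->; rewrite f0 mulr0.
rewrite exchange_big; apply: eq_bigr => x _.
have [ain|aout] := boolP ((g * (F x)^-1)%g \in finsupp a).
  rewrite (bigD1_seq _ ain (fset_uniq _))//= big1 ?addr0 => [|h /negPf hx]; rewrite /t ?eqxx//.
  by rewrite hx.
rewrite (fsfun_dflt aout) mul0r big_seq big1// => h hin; rewrite /t.
by case: eqP hin => // ->; rewrite (negPf aout).
Qed.

Lemma convolution_lin (a : group_algebra R G) (c : C) (f f' : G -> C) g :
  convolution a (fun x => c * f x + f' x) g =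
  c * convolution a f g + convolution a f' g :> C.
Proof.
rewrite /convolution mulr_sumr -big_split; apply: eq_bigr => h _ /=.
by rewrite [LHS]mulrDr mulrCA.
Qed.

Lemma convolution_translate (a : group_algebra R G) (f : G -> C) t g :
  convolution a (fun x => f (x * t)%g) g = convolution a f (g * t)%g :> C.
Proof. by apply: eq_bigr => h _; rewrite mulgA. Qed.

End Convolution.

Section Kernel.
Variables (R : realType) (G : groupType) (d : nat) (A : 'M[group_algebra R G]_d).
Local Notation C := (R[i]).
Local Notation vec := ('I_d -> G -> C).
Local Notation K := (matrix_ker A).

Lemma matrix_op_lin (a : C) (u v : vec) i g :
  matrix_op A (lin a u v) i g = a * matrix_op A u i g + matrix_op A v i g :> C.
Proof.
rewrite /matrix_op mulr_sumr -big_split; apply: eq_bigr => j _ /=.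
exact: convolution_lin.
Qed.

Lemma matrix_op_translate t (u : vec) i g :
  matrix_op A (translate t u) i g = matrix_op A u i (g * t)%g :> C.
Proof. by apply: eq_bigr => j _; exact: convolution_translate. Qed.

Lemma matrix_ker_l2d : K `<=` @l2d R G d. Proof. by move=> u []. Qed.

Lemma matrix_ker_subspace : subspace K.
Proof.
split=> [|a u v [lu u0] [lv v0]].
  split=> [|i g]; first exact: (subspace_l2d R G d).1.
  by rewrite /matrix_op big1// => j _; rewrite /convolution big1// => h _; rewrite mulr0.
split=> [|i g]; first exact: l2d_lin.
by rewrite matrix_op_lin u0 v0 mulr0 addr0.
Qed.

(** Each of the equations that define the kernel involves finitely many values
    of the vector. *)
Lemma matrix_ker_closed : pointwise_closed K.
Proof.
move=> un p Kun lp unp; split=> // i g.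
have opP : (matrix_op A (un n) i g : R[i]^o) @[n --> \oo] -->
    (matrix_op A p i g : R[i]^o).
  apply: cvg_big => [|j _]; first exact: add_continuous.
  apply: cvg_big => [|h _]; first exact: add_continuous.
  exact: (@cvgZl_tmp _ (R[i]^o) _ _ _ (A i j h) _ _ (unp j (h^-1 * g)%g)).
have op0 : (matrix_op A (un n) i g : R[i]^o) @[n --> \oo] --> (0 : R[i]^o).
  have -> : (fun n => matrix_op A (un n) i g) = (fun=> 0).
    by apply/funext => n; exact: (Kun n).2.
  exact: cvg_cst.
exact: (cvg_unique (@norm_hausdorff _ (R[i]^o)) opP op0).
Qed.

Lemma matrix_ker_translate t (u : vec) : K u -> K (translate t u).
Proof.
move=> [lu u0]; split=> [|i g]; first exact: l2d_translate.
by rewrite matrix_op_translate.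
Qed.

Lemma orthogonal_projectionP (u : vec) : l2d u ->
  is_orthogonal_projection K u (orthogonal_projection K u).
Proof.
move=> lu; apply: xgetPex.
exact: (projection_exists matrix_ker_subspace matrix_ker_l2d matrix_ker_closed lu).
Qed.

(** The projection onto ker A of the delta function at t, obtained by
    translation from the one at the unit of G, so that its diagonal values do
    not depend on the element of G. *)
Definition delta_proj (t : 'I_d * G) : vec :=
  translate t.2^-1%g (orthogonal_projection K (l2d_unit R t.1)).

(** Right translations are isometries and preserve ker A, since A acts from the
    left. *)
Lemma delta_projP t : is_orthogonal_projection K (delta R t) (delta_proj t).
Proof.
case: t => i x; rewrite /delta_proj /=.
have [Kp orth] := orthogonal_projectionP (l2d_delta R (i, 1%g) : l2d (l2d_unit R i)).
split; first exact: matrix_ker_translate.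
move=> w Kw; set p := orthogonal_projection _ _ in Kp orth *.
have lw := matrix_ker_l2d Kw; have lp := matrix_ker_l2d Kp.
rewrite -[RHS](orth _ (matrix_ker_translate x Kw)) !sub_lin.
rewrite -[RHS](l2d_inner_translate x^-1%g); last exact: l2d_translate.
  congr (l2d_inner _ _); apply/funext => j; apply/funext => g.
    rewrite /translate /lin /delta /=; congr (_ + _).
    by rewrite /l2d_unit divg_eq1.
  by rewrite /translate mulgVK.
exact: (l2d_lin _ lp (l2d_delta R (i, 1%g))).
Qed.

Lemma dimG_kerE : dimG_ker A = \sum_i delta_proj (i, 1%g) i 1%g :> C.
Proof.
apply: eq_bigr => i _.
have [Kp _] := orthogonal_projectionP (l2d_delta R (i, 1%g) : l2d (l2d_unit R i)).
rewrite (l2d_inner_delta (i, 1%g) (matrix_ker_l2d Kp)) /delta_proj /translate /=.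
by rewrite invg1 mulg1.
Qed.

Lemma delta_proj_diag i x : delta_proj (i, x) i x = delta_proj (i, 1%g) i 1%g.
Proof. by rewrite /delta_proj /translate /= mulgV invg1 mulg1. Qed.

End Kernel.

(** * Bounds by a finite window *)

Section Gram.
Variables (R : realType) (G : groupType) (d N : nat).
Local Notation C := (R[i]).
Local Notation vec := ('I_d -> G -> C).
Local Notation ip := (@l2d_inner R G d).

Definition row_comb (v : 'rV[C]_N) (e : 'I_N -> vec) : vec :=
  comb (index_enum 'I_N) (v 0) e.

(** If the e b are orthonormal and p a is the projection of e a, this is the
    matrix of the compression of the projection to the span of the e b. *)
Definition gram (p e : 'I_N -> vec) : 'M[C]_N := \matrix_(a, b) ip (p a) (e b).

Lemma l2d_row_comb v (e : 'I_N -> vec) : (forall a, l2d (e a)) -> l2d (row_comb v e).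
Proof. exact: (subspace_comb _ _ (subspace_l2d R G d)). Qed.

Lemma gram_hform (p e : 'I_N -> vec) v :
  (forall a, l2d (p a)) -> (forall a, l2d (e a)) ->
  hform (gram p e) v = ip (row_comb v p) (row_comb v e).
Proof.
move=> lp le; have lpv := l2d_row_comb v lp; have lev := l2d_row_comb v le.
rewrite l2d_inner_comb// /hform mxE.
under eq_bigr do rewrite !mxE mulr_suml.
rewrite exchange_big; apply: eq_bigr => a _ /=.
rewrite (l2d_inner_conj lev (lp a)) l2d_inner_comb// rmorph_sum mulr_sumr.
apply: eq_bigr => b _.
by rewrite rmorphM /= -(l2d_inner_conj (le b) (lp a)) !mxE mulrA mulrAC.
Qed.

Variables (K : set vec) (p e : 'I_N -> vec).
Hypotheses (subK : subspace K) (Kl2 : K `<=` @l2d R G d).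
Hypotheses (le : forall a, l2d (e a)).
Hypotheses (pP : forall a, is_orthogonal_projection K (e a) (p a)).

Let lp a : l2d (p a). Proof. exact: Kl2 (pP a).1. Qed.

Let Kpv v : K (row_comb v p).
Proof. by apply: subspace_comb => // a; exact: (pP a).1. Qed.

Lemma row_comb_orthogonal v w : K w -> ip (row_comb v e) w = ip (row_comb v p) w.
Proof.
move=> Kw; have lw := Kl2 Kw; rewrite !l2d_inner_comb//.
apply: eq_bigr => a _; congr (_ * _); apply/eqP; rewrite -subr_eq0.
have := (pP a).2 w Kw; rewrite sub_lin l2d_inner_lin// => h.
by rewrite addrC -mulN1r h.
Qed.

(** With e = row_comb v e and p = row_comb v p, the vector p is the projection
    of e, so <p, e> = |p|^2 and <e, e> - <p, e> = |e - p|^2. *)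
Lemma gram_projection_bounds v :
  0 <= hform (gram p e) v <= hform (gram e e) v.
Proof.
have lpv := l2d_row_comb v lp; have lev := l2d_row_comb v le.
have pe : ip (row_comb v p) (row_comb v e) = ip (row_comb v p) (row_comb v p).
  rewrite (l2d_inner_conj lev lpv) row_comb_orthogonal// -l2d_inner_conj//.
rewrite !gram_hform// pe l2d_inner_ge0//= -subr_ge0.
have -> : ip (row_comb v e) (row_comb v e) - ip (row_comb v p) (row_comb v p) =
    ip (lin (-1) (row_comb v p) (row_comb v e)) (lin (-1) (row_comb v p) (row_comb v e)).
  rewrite inner_lin_lin// pe (row_comb_orthogonal v (Kpv v)) rmorphN rmorph1; ring.
by rewrite l2d_inner_ge0//; exact: l2d_lin.
Qed.

Lemma gram_projection_id v :
  K (row_comb v e) -> hform (gram p e) v = hform (gram e e) v.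
Proof. by move=> Kv; rewrite !gram_hform// row_comb_orthogonal. Qed.

End Gram.

Section Window.
Variables (C : numClosedFieldType) (d n m : nat).

(** The equations (A u)(i, E y) = 0 for a vector u supported on F: the column
    (i, y) holds the coefficients c i j x y of u(j, F x). *)
Definition window_mx (c : 'I_d -> 'I_d -> 'I_n -> 'I_m -> C) :
    'M[C]_(#|{: 'I_d * 'I_n}|, #|{: 'I_d * 'I_m}|) :=
  \matrix_(a, b) c (enum_val b).1 (enum_val a).1 (enum_val a).2 (enum_val b).2.

End Window.

Section WindowBounds.
Variables (R : realType) (G : groupType) (d : nat) (A : 'M[group_algebra R G]_d).
Local Notation C := (R[i]).
Local Notation vec := ('I_d -> G -> C).
Local Notation K := (matrix_ker A).
Variables (n m : nat) (F : 'I_n -> G) (E : 'I_m -> G) (b : pred 'I_m) (S : seq G).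
Hypotheses (F_inj : injective F)
  (suppS : forall i j h, h \in finsupp (A i j) -> h \in S)
  (E_cover : forall h x, h \in S -> exists y, E y = (h * F x)%g)
  (interior : forall y h, ~~ b y -> h \in S -> exists x, (h^-1 * E y)%g = F x).

Local Notation N := #|{: 'I_d * 'I_n}|.

Definition window_coef i j x y : C := A i j (E y * (F x)^-1)%g.
Local Notation T := (window_mx window_coef).

Let pos (a : 'I_N) : 'I_d * G := ((enum_val a).1, F (enum_val a).2).

Let pos_inj : injective pos.
Proof.
move=> a a'; rewrite /pos => -[e1 /F_inj e2]; apply: enum_val_inj.
by rewrite [LHS]surjective_pairing [RHS]surjective_pairing e1 e2.
Qed.

Let e a : vec := delta R (pos a).
Let p a : vec := delta_proj A (pos a).

Let le a : l2d (e a). Proof. exact: l2d_delta. Qed.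
Let pP a : is_orthogonal_projection K (e a) (p a). Proof. exact: delta_projP. Qed.
Let lp a : l2d (p a). Proof. exact: matrix_ker_l2d (pP a).1. Qed.

Lemma gram_delta : gram e e = 1%:M.
Proof.
apply/matrixP => a a'; rewrite !mxE (l2d_inner_delta (pos a') (le a)) /e /delta.
rewrite -[(_ && _)]/(pos a' == pos a) (inj_eq pos_inj) eq_sym.
by case: eqP.
Qed.

Lemma sum_pos (f : 'I_d -> 'I_n -> C) :
  \sum_(a < N) f (enum_val a).1 (enum_val a).2 = \sum_j \sum_x f j x.
Proof.
by rewrite pair_bigA /= (big_enum_val (fun t => f t.1 t.2)).
Qed.

Lemma matrix_op_window (u : vec) i g :
  (forall j h, h \in S -> (exists x, (h^-1 * g)%g = F x) \/ u j (h^-1 * g)%g = 0) ->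
  matrix_op A u i g = \sum_j \sum_x A i j (g * (F x)^-1)%g * u j (F x) :> C.
Proof.
move=> supp; apply: eq_bigr => j _; apply: convolution_window => // h /suppS hS.
exact: supp.
Qed.

Lemma row_comb_delta (v : 'rV[C]_N) a : row_comb v e (pos a).1 (pos a).2 = v 0 a.
Proof.
rewrite /row_comb /comb (bigD1 a)//= big1 ?addr0 => [|a' aa'].
  by rewrite /e /delta !eqxx mulr1.
rewrite /e /delta -[(_ && _)]/(pos a == pos a') (inj_eq pos_inj) eq_sym.
by rewrite (negPf aa') mulr0.
Qed.

Lemma row_comb_delta_out (v : 'rV[C]_N) j g :
  (forall x, g <> F x) -> row_comb v e j g = 0.
Proof.
move=> gF; rewrite /row_comb /comb big1// => a _.
by rewrite /e /delta /=; case: eqP => // _; case: eqP => [/gF//|_]; rewrite mulr0.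
Qed.

(** For a vector supported on F the equations at the points of E are all the
    equations, because A maps it to a vector supported on supp(A) F. *)
Lemma window_kernel (v : 'rV[C]_N) : v *m T = 0 -> K (row_comb v e).
Proof.
move=> vT; split=> [|i g]; first exact: l2d_row_comb.
rewrite matrix_op_window => [|j h _]; last first.
  have [?|no] := pselect (exists x, (h^-1 * g)%g = F x); [by left|right].
  by apply: row_comb_delta_out => x hx; apply: no; exists x.
have [[y <-]|gE] := pselect (exists y, E y = g); last first.
  rewrite big1// => j _; rewrite big1// => x _.
  rewrite fsfun_dflt ?mul0r//; apply/negP => /suppS /(E_cover x)[y Ey].
  by apply: gE; exists y; rewrite Ey mulgVK.
have := congr1 (fun M : 'rV_ _ => M 0 (enum_rank (i, y))) vT.
rewrite !mxE => vT0; apply: etrans vT0; rewrite -sum_pos; apply: eq_bigr => a _.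
rewrite !mxE enum_rankK /window_coef mulrC; congr (_ * _).
exact: row_comb_delta v a.
Qed.

(** At an interior point of F an element of ker A satisfies an equation that
    only involves its values on F. *)
Lemma window_image a c : ~~ b (enum_val c).2 -> (gram p e *m T) a c = 0.
Proof.
move=> bc; rewrite -[RHS]((pP a).1.2 (enum_val c).1 (E (enum_val c).2)).
rewrite matrix_op_window => [|j h hS]; last by left; exact: interior.
rewrite !mxE -sum_pos; apply: eq_bigr => a' _.
rewrite !mxE mulrC; congr (_ * _).
exact: (l2d_inner_delta (pos a') (lp a)).
Qed.

Lemma trace_gram : \tr (gram p e) = n%:R * dimG_ker A.
Proof.
rewrite /mxtrace dimG_kerE.
transitivity (\sum_(a < N) (fun j _ => delta_proj A (j, 1%g) j 1%g)
    (enum_val a).1 (enum_val a).2).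
  apply: eq_bigr => a _; rewrite mxE (l2d_inner_delta (pos a) (lp a)).
  exact: delta_proj_diag.
rewrite (sum_pos (fun j _ => delta_proj A (j, 1%g) j 1%g)) mulr_sumr.
by apply: eq_bigr => j _; rewrite sumr_const card_ord mulr_natl.
Qed.

(** The rank of T is determined by the coefficients of A at the elements
    E y (F x)^-1, which makes the bounds comparable between different groups. *)
Theorem dimG_ker_window :
  (N - \rank T)%:R <= n%:R * (dimG_ker A : C) <= (N - \rank T)%:R + (d * #|b|)%:R.
Proof.
have subK := matrix_ker_subspace A; have Kl2 := @matrix_ker_l2d _ _ _ A.
rewrite -trace_gram.
have -> : (d * #|b|)%N = #|[pred c : 'I_#|{: 'I_d * 'I_m}| | b (enum_val c).2]|.
  transitivity (\sum_(t : 'I_d * 'I_m) (if b t.2 then 1 else 0))%N.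
    rewrite -(pair_bigA _ (fun _ y => if b y then 1 else 0)%N) /=.
    by rewrite sum_nat_const card_ord -big_mkcond sum1_card.
  by rewrite (big_enum_val (fun t => if b t.2 then 1 else 0)%N) -big_mkcond sum1_card.
apply: kernel_trace_bounds => [v|v vT|a c bc].
- by rewrite -gram_delta; exact: (gram_projection_bounds subK Kl2 le pP).
- by rewrite -gram_delta; exact: (gram_projection_id Kl2 le pP (window_kernel vT)).
- exact: window_image.
Qed.

End WindowBounds.

Section QuotientAlgebra.
Variables (R : realType) (G : groupType).

Lemma quo_algebra_supp (N : normalSubgroup G) (a : group_algebra R G) q :
  q \in finsupp (quo_algebra N a) -> exists2 g, g \in finsupp a & q = quo N g.
Proof.
move=> /(fsubsetP (finsupp_sub _ _ _)) /imfsetP[g /= ga ->].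
by exists g.
Qed.

(** If no other element of the support of a has the same image as g, the sum
    over the fibre of g reduces to a g. *)
Lemma quo_algebra_val (N : normalSubgroup G) (a : group_algebra R G) g :
  (forall h, h \in finsupp a -> quo N h = quo N g -> h = g) ->
  quo_algebra N a (quo N g) = a g.
Proof.
move=> inj; rewrite fsfunE.
have sumE : g \in finsupp a ->
    \sum_(h <- finsupp a | quo N h == quo N g) a h = a g.
  move=> ga; rewrite big_mkcond (bigD1_seq _ ga (fset_uniq _)) /= eqxx.
  rewrite big_seq_cond big1 ?addr0// => h /andP[ha hg].
  by case: eqP => // /inj -/(_ ha) hgE; rewrite hgE eqxx in hg.
case: ifPn => [/imfsetP[h /= ha /esym gh]|gout].
  by apply: sumE; rewrite -(inj h ha gh).
rewrite fsfun_dflt//; apply: contra gout => ga.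
by apply/imfsetP; exists g.
Qed.

(** Each x^-1 y <> 1 is outside some G_k, hence outside all later ones. *)
Lemma quo_eventually_injective (Gk : nat -> normalSubgroup G) (L : seq G) :
  (forall k, {subset Gk k.+1 <= Gk k}) ->
  (forall x, (forall k, x \in Gk k) -> x = 1%g) ->
  exists k0, forall k, (k0 <= k)%N -> {in L &, injective (quo (Gk k))}.
Proof.
move=> nested trivial.
have desc k k' : (k <= k')%N -> {subset Gk k' <= Gk k}.
  move=> /subnK <-; elim: (k' - k)%N => // l IH x; rewrite addSn => /nested.
  exact: IH.
have sep x : exists k0, x \in Gk k0 -> x = 1%g.
  have [->|x1] := eqVneq x 1%g; first by exists 0%N.
  have [[k /negP kx]|all_k] := pselect (exists k, ~ (x \in Gk k)).
    by exists k => xk; rewrite xk in kx.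
  by exists 0%N => _; apply: trivial => k; apply: contrapT => kx; apply: all_k; exists k.
pose k_ x := projT1 (cid (sep x)).
have k_P x : x \in Gk (k_ x) -> x = 1%g := projT2 (cid (sep x)).
exists (\max_(x <- L) \max_(y <- L) k_ (x^-1 * y)%g) => k kmax x y xL yL.
move=> /quo_eqP xyk; have /k_P xy1 : (x^-1 * y)%g \in Gk (k_ (x^-1 * y)%g).
  apply: desc xyk; apply: leq_trans kmax.
  apply: (leq_trans _ (@leq_bigmax_seq _ L xpredT _ x xL isT)).
  exact: (@leq_bigmax_seq _ L xpredT (fun y => k_ (x^-1 * y)%g) y yL isT).
by apply: (mulgI x^-1%g); rewrite mulVg xy1.
Qed.

End QuotientAlgebra.

Lemma dist_le_of_bounds (C : numDomainType) (a b x y : C) : a \is Num.real ->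
  a <= x <= a + b -> a <= y <= a + b -> `|x - y| <= b.
Proof.
move=> ar /andP[ax xb] /andP[ay yb].
have xr : x \is Num.real by rewrite -(subrK a x) rpredD// ger0_real// subr_ge0.
have yr : y \is Num.real by rewrite -(subrK a y) rpredD// ger0_real// subr_ge0.
rewrite real_ler_norml ?rpredB//; apply/andP; split.
  by rewrite lerBrDl -lerBrDr opprK (le_trans yb)// lerD2r.
by rewrite lerBlDr (le_trans xb)// addrC lerD2l.
Qed.

Section FolnerBoundary.
Variables (R : realType) (G : groupType) (d : nat) (A : 'M[group_algebra R G]_d).

Definition matrix_supp : seq G :=
  flatten [seq enum_fset (finsupp (A i j)) | i <- enum 'I_d, j <- enum 'I_d].

Lemma matrix_suppP i j h : h \in finsupp (A i j) -> h \in matrix_supp.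
Proof.
move=> hA; apply/flattenP; exists (enum_fset (finsupp (A i j))) => //.
by apply/allpairsP; exists (i, j); rewrite !mem_enum.
Qed.

(** Tells the points g where the equation (A u)(g) = 0 may involve values of u
    outside F, when S contains the supports of the entries of A. *)
Definition escapes (S F : seq G) (g : G) : bool :=
  has (fun h => (h^-1 * g)%g \notin F) S.

(** A point h x of S F with x in F escapes if h'^-1 h x is outside F for some
    h' in S, so that F only has to be almost invariant under the products
    h'^-1 h. *)
Lemma folner_boundary (m : nat) (S : seq G) : folner G -> exists F : seq G,
  [/\ uniq F, (0 < size F)%N &
   (m * count (escapes S F) [seq (h * x)%g | h <- S, x <- F] <=
     size S * size S * size F)%N].
Proof.
move=> /(_ [seq (h'^-1 * h)%g | h' <- S, h <- S] m)[F [uF F0 FS]].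
exists F; split=> //.
rewrite -sum1_count big_mkcond big_allpairs_dep /= big_distrr /=.
rewrite -mulnA -[X in (X * _)%N]sum1_size big_distrl /= !big_seq leq_sum// => h hS.
rewrite mul1n -big_mkcond sum1_count.
apply: (@leq_trans (\sum_(h' <- S)
    m * count (fun x => (h'^-1 * h * x)%g \notin F) F)).
  rewrite -big_distrr leq_mul2l; apply/orP; right => {FS}.
  elim: S {hS} => [|h' S IH].
    by rewrite big_nil (@eq_count _ _ pred0) ?count_pred0.
  rewrite big_cons.
  have -> : count (fun x => escapes (h' :: S) F (h * x)%g) F =
      count (predU (fun x => (h'^-1 * h * x)%g \notin F)
                   (fun x => escapes S F (h * x)%g)) F.
    by apply: eq_count => x; rewrite /escapes /= mulgA.
  apply: leq_trans (leq_add (leqnn _) IH).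
  by rewrite -count_predUI leq_addr.
rewrite -[X in (X * _)%N]sum1_size big_distrl /= !big_seq leq_sum// => h' h'S.
rewrite mul1n; apply: FS; apply/allpairsP; exists (h', h); split=> //.
Qed.

End FolnerBoundary.

(** * Comparison with the quotients *)

Section Comparison.
Variables (R : realType) (G : groupType) (d : nat) (A : 'M[group_algebra R G]_d).
Local Notation C := (R[i]).
Local Notation S := (matrix_supp A).

(** The injectivity hypothesis covers the elements of supp(A), so that the
    coefficients of A and of its image agree, the elements of F, so that its
    image has as many elements, and the arguments g x^-1 of the coefficients. *)
Lemma dimG_ker_quotient_close (N : normalSubgroup G) (F : seq G) :
  uniq F -> (0 < size F)%N ->
  let E := [seq (h * x)%g | h <- S, x <- F] in
  {in S ++ F ++ [seq (g * x^-1)%g | g <- E, x <- F] &, injective (quo N)} ->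
  `|dimG_ker A - dimG_ker (map_mx (quo_algebra N) A) : C| <=
    (d * count (escapes S F) E)%:R / (size F)%:R.
Proof.
move=> uF F0 E q_inj.
pose Fn (x : 'I_(size F)) := nth 1%g F x.
pose En (y : 'I_(size E)) := nth 1%g E y.
pose b y := escapes S F (En y).
have FnF x : Fn x \in F by rewrite mem_nth.
have EnE y : En y \in E by rewrite mem_nth.
have nthF g : g \in F -> exists x, g = Fn x.
  rewrite -index_mem => gF; exists (Ordinal gF).
  by rewrite /Fn /= nth_index// -index_mem.
have Fn_inj : injective Fn.
  by move=> x x' /eqP; rewrite nth_uniq// => /eqP /val_inj.
have cover h x : h \in S -> exists y, En y = (h * Fn x)%g.
  move=> hS; have hxE : (h * Fn x)%g \in E.
    by apply/allpairsP; exists (h, Fn x); split=> //=; exact: FnF.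
  have lt : (index (h * Fn x)%g E < size E)%N by rewrite index_mem.
  by exists (Ordinal lt); rewrite /En /= nth_index.
have interior y h : ~~ b y -> h \in S -> exists x, (h^-1 * En y)%g = Fn x.
  by move=> /hasPn yb /yb; rewrite negbK => /nthF.
have boundG := dimG_ker_window Fn_inj (@matrix_suppP _ _ _ A) cover interior.
pose L := S ++ F ++ [seq (g * x^-1)%g | g <- E, x <- F].
have SL h : h \in S -> h \in L by rewrite mem_cat => ->.
have FL x : Fn x \in L by rewrite !mem_cat FnF orbT.
have EL y x : (En y * (Fn x)^-1)%g \in L.
  rewrite !mem_cat; apply/orP; right; apply/orP; right.
  by apply/allpairsP; exists (En y, Fn x); split=> //=.
set Aq := map_mx _ A.
have qF_inj : injective (fun x => quo N (Fn x)).
  by move=> x x' /(q_inj _ _ (FL x) (FL x')) /Fn_inj.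
have q_supp i j q : q \in finsupp (Aq i j) -> q \in map (quo N) S.
  by rewrite mxE => /quo_algebra_supp[g /matrix_suppP gS ->]; exact: map_f.
have q_cover q x : q \in map (quo N) S ->
    exists y, quo N (En y) = (q * quo N (Fn x))%g.
  by move=> /mapP[h hS ->]; have [y hy] := cover h x hS; exists y; rewrite hy quo_morph.
have q_interior y q : ~~ b y -> q \in map (quo N) S ->
    exists x, (q^-1 * quo N (En y))%g = quo N (Fn x).
  move=> yb /mapP[h hS ->]; have [x hx] := interior y h yb hS; exists x.
  by rewrite -hx quo_morph multiplicativeV.
have boundQ := dimG_ker_window qF_inj q_supp q_cover q_interior.
have eqT : window_mx (window_coef Aq (fun x => quo N (Fn x)) (fun y => quo N (En y)))
    = window_mx (window_coef A Fn En).
  congr window_mx; do 4 (apply/funext => ?).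
  rewrite /window_coef mxE -multiplicativeV -quo_morph quo_algebra_val//.
  by move=> h /matrix_suppP /SL hL; apply: q_inj => //; exact: EL.
rewrite eqT in boundQ.
have := dist_le_of_bounds (ger0_real (ler0n _ _)) boundG boundQ.
have -> : #|[pred y | b y]| = count (escapes S F) E.
  rewrite -sum1_card -sum1_count (big_nth 1%g) big_mkord.
  by apply: eq_bigl => y.
rewrite -mulrBr normrM normr_nat => h.
by rewrite ler_pdivlMr ?ltr0n// mulrC.
Qed.

End Comparison.

Theorem proposition1p10 (R : realType) (G : groupType)
    (Gk : nat -> normalSubgroup G)
    (torsion_free_G : torsion_free G)
    (elementary_amenable_G : elementary_amenable G)
    (nested : forall k : nat, {subset Gk k.+1 <= Gk k})
    (trivial_intersection :
       forall x : G, (forall k : nat, x \in Gk k) -> x = 1%g)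
    (quotients_in_class_G : forall k : nat, class_G R (quotient_group (Gk k)))
    (d : nat) (A : 'M[group_algebra R G]_d) :
  dimG_ker (map_mx (quo_algebra (Gk k)) A) @[k --> \oo] --> dimG_ker A.
Proof.
apply/(@cvgrPdist_le _ (R[i]^o)) => e e0.
have eR : e = (complex.Re e)%:C%C by rewrite RRe_real// gtr0_real.
have e0R : 0 < complex.Re e by rewrite -ltcR -eR.
pose s := size (matrix_supp A).
(* m is larger than d s^2 / e, so that d s^2 / m, which bounds d |boundary| / |F|,
   is smaller than e *)
pose m := (Num.truncn ((d * s * s)%:R / complex.Re e)).+1.
have [F [uF F0 Fm]] :=
  folner_boundary m (matrix_supp A) (elementary_amenable_folner elementary_amenable_G).
set E := [seq _ | _ <- _, _ <- _] in Fm.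
have [k0 k0P] := quo_eventually_injective
  (matrix_supp A ++ F ++ [seq (g * x^-1)%g | g <- E, x <- F]) nested trivial_intersection.
exists k0 => // k /k0P q_inj.
apply: (le_trans (dimG_ker_quotient_close uF F0 q_inj)).
rewrite ler_pdivrMr ?ltr0n// eR.
rewrite -(rmorph_nat (real_complex R)) -(rmorph_nat (real_complex R) (size F)).
rewrite -rmorphM lecR.
have m0 : 0 < m%:R :> R by rewrite ltr0n.
rewrite -(ler_pM2l m0).
apply: (@le_trans _ _ ((d * s * s)%:R * (size F)%:R)).
  rewrite -!natrM ler_nat mulnCA -!mulnA leq_mul2l mulnA; apply/orP; right.
  exact: Fm.
rewrite mulrA ler_wpM2r// -ler_pdivrMr//.
exact/ltW/truncnS_gt.
Qed.
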